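(* Let $B\subseteq\Gamma^{\omega}(\mathbb{R}^n)$ be a set of real analytic vector fields on $\mathbb{R}^n$ which is bounded in $\mathrm{LC}^{\omega}(\mathbb{R}^n)$ with respect to the $\mathrm{C}^{\omega}$-topology (vector fields being identified with derivations of $\mathrm{C}^\omega(\mathbb{R}^n)$), let $x_0\in\mathbb{R}^n$, and let $T_B>0$ be such that for every $X\in\mathrm{PC}([0,T_B];B)$ and every $k\in\mathbb{N}$ the flow iteration $t\mapsto\widehat{\exp}_k(tX)$ is defined on $[0,T_B]$. Then there exist $M,L>0$ and $0<\overline{T}\le T_B$ with $M\overline{T}<1$ such that, for every $X\in\mathrm{PC}([0,\overline{T}];B)$, every $k\in\mathbb{N}$ and every $i\in\{1,2,\ldots,n\}$, $$\left|\mathrm{ev}_{x_0}\circ\widehat{\exp}(tX)(x^i)-\mathrm{ev}_{x_0}\circ\widehat{\exp}_k(tX)(x^i)\right|\le\frac{(Mt)^{k+1}}{1-Mt}L,\qquad\forall t\in[0,\overline{T}],$$ where $x^i$ is the $i$th coordinate function on $\mathbb{R}^n$.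
   Context: $\mathrm{C}^\omega(\mathbb{R}^n)$ is the space of real analytic functions on $\mathbb{R}^n$, $\Gamma^\omega(\mathbb{R}^n)$ the space of real analytic vector fields, and $\mathrm{LC}^\omega(\mathbb{R}^n)$ the space of linear maps $\mathrm{C}^\omega(\mathbb{R}^n)\to\mathrm{C}^\omega(\mathbb{R}^n)$. A vector field $V$ is identified with the derivation $\widehat{V}(f)=\mathcal{L}_Vf$ (Lie derivative), and a real analytic diffeomorphism $\phi$ with $\widehat{\phi}(f)=f\circ\phi$. $\mathrm{ev}_{x_0}(f)=f(x_0)$. Let $c_0^{\downarrow}$ be the set of decreasing sequences $\mathbf{a}=(a_0,a_1,\ldots)$ of positive reals converging to $0$. The $\mathrm{C}^\omega$-topology on $\mathrm{LC}^\omega(\mathbb{R}^n)$ is the locally convex topology generated by the seminorms, for $K\subset\mathbb{R}^n$ compact, $\mathbf{a}\in c_0^{\downarrow}$, $f\in\mathrm{C}^\omega(\mathbb{R}^n)$, $$\rho^\omega_{K,\mathbf{a},f}(A)=\sup\left\{\frac{a_0a_1\cdots a_{|r|}}{|r|!}\left\|D^{(r)}(Af)(x)\right\|\ \middle|\ x\in K,\ r\in\mathbb{Z}_{\ge0}^n\right\}.$$ A set is bounded iff each of these seminorms is bounded on it. For an interval $\mathbb{T}$ and $S\subseteq\mathrm{LC}^\omega(\mathbb{R}^n)$, $\mathrm{PC}(\mathbb{T};S)$ is the set of piecewise constant curves $\lambda:\mathbb{T}\to\mathrm{LC}^\omega(\mathbb{R}^n)$ with $\lambda(t)\in S$ for almost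 every $t\in\mathbb{T}$. An element $X\in\mathrm{PC}(\mathbb{T};B)$, $t\mapsto\widehat{X}(t)$, is thus a piecewise constant (in time) real analytic vector field $X(t,x)$. Flow: $t\mapsto\exp(tX)(x_0)$ is the absolutely continuous solution of $\frac{d}{dt}\exp(tX)(x_0)=X(t,\exp(tX)(x_0))$ for almost every $t$, with $\exp(0X)(x_0)=x_0$; $\widehat{\exp}(tX)$ is composition with the flow map $\exp(tX)$, so that $\mathrm{ev}_{x_0}\circ\widehat{\exp}(tX)(x^i)$ is the $i$th coordinate of $\exp(tX)(x_0)$ (the inequality includes that this solution exists on $[0,\overline{T}]$). Flow iterations: $\widehat{\exp}_0(tX)=\mathrm{id}$ and, for $k\in\mathbb{N}=\{1,2,\ldots\}$, $$\widehat{\exp}_k(tX)=\mathrm{id}+\int_0^t\widehat{\exp}_{k-1}(\tau X)\circ\widehat{X}(\tau)\,d\tau .$$ *)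

(* Defs.v *)
From HB Require Import structures.
From mathcomp Require Export all_boot all_order all_algebra.
From mathcomp Require Export all_classical all_reals all_analysis.
From mathcomp Require Export measurable_realfun.

#[export] Set Implicit Arguments.
#[export] Unset Strict Implicit.
#[export] Unset Printing Implicit Defensive.

Export Order.TTheory GRing.Theory Num.Theory.
Export numFieldNormedType.Exports.

Local Open Scope classical_set_scope.
Local Open Scope ring_scope.

Section RealAnalytic.
Variables (R : realType) (n : nat).
Implicit Types (f g : 'rV[R]_n -> R^o) (x y h : 'rV[R]_n).
Implicit Types (c : ('I_n -> nat) -> R).

Definition power_term c h (N : nat) (r : {ffun 'I_n -> 'I_N}) : R :=
  c (fun i => r i : nat) * \prod_i h ord0 i ^+ r i.

(* f is, near each point x, the sum of an absolutely convergent power series;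
   sums over multi-indices are exhausted by the cubes {0, .., N-1}^n. *)
Definition real_analytic f : Prop :=
  forall x, exists c, exists2 e : R, 0 < e & forall y, ball x e y ->
    (exists C : R, forall N : nat,
       \sum_(r : {ffun 'I_n -> 'I_N}) `|power_term c (y - x) r| <= C) /\
    (fun N : nat => \sum_(r : {ffun 'I_n -> 'I_N}) power_term c (y - x) r)
      @ \oo --> (f y : R).

Definition analytic_pred : {pred 'rV[R]_n -> R^o} :=
  mem [set f | real_analytic f].

Lemma analytic_predP f : reflect (real_analytic f) (f \in analytic_pred).
Proof. by apply: (iffP idP) => [/set_mem//|/mem_set]. Qed.

Lemma real_analytic_cst (a : R) : real_analytic (fun=> a).
Proof.
move=> x; exists (fun r => if [forall i, r i == 0%N] then a else 0), 1 => //.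
move=> y _.
have E N (g : R -> R) : g 0 = 0 ->
    \sum_(r : {ffun 'I_n -> 'I_N.+1})
      g (power_term (fun r => if [forall i, r i == 0%N] then a else 0) (y - x) r)
    = g a.
  move=> g0; rewrite (bigD1 [ffun=> ord0])//= big1 ?addr0 => [|r rN0].
    rewrite /power_term; case: ifPn => [_|/forallPn[i]].
      by rewrite big1 ?mulr1// => i _; rewrite ffunE expr0.
    by rewrite ffunE eqxx.
  rewrite /power_term; case: ifPn => [/forallP r0|_]; last by rewrite mul0r.
  case/eqP: rN0; apply/ffunP => i; rewrite ffunE; apply/val_inj.
  exact/eqP/r0.
split.
  exists (\sum_(r : {ffun 'I_n -> 'I_0}) `|power_term
     (fun r => if [forall i, r i == 0%N] then a else 0) (y - x) r| + `|a|).
  by case=> [|N]; [rewrite lerDl|rewrite (E _ Num.norm) ?normr0// lerDr sumr_ge0].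
rewrite -cvg_shiftS; apply: cvg_near_cst; apply: nearW => N /=.
exact: (E N id).
Qed.

Lemma real_analytic_coord (i : 'I_n) : real_analytic (fun x => x ord0 i).
Proof.
move=> x.
pose c (r : 'I_n -> nat) : R :=
  if [forall j, r j == 0%N] then x ord0 i
  else if [forall j, r j == (j == i)] then 1 else 0.
exists c, 1 => // y _.
have E N (g : R -> R) : g 0 = 0 ->
    \sum_(r : {ffun 'I_n -> 'I_N.+2}) g (power_term c (y - x) r)
    = g (x ord0 i) + g ((y - x) ord0 i).
  move=> g0; rewrite (bigD1 [ffun=> ord0])//=.
  rewrite (bigD1 [ffun j => inord (j == i)])/=; last first.
    apply/eqP => /ffunP/(_ i); rewrite !ffunE eqxx => /(congr1 val) /=.
    by rewrite inordK.
  rewrite big1 ?addr0 => [|r /andP[rN0 rNi]].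
    congr (g _ + g _); rewrite /power_term /c.
      case: ifPn => [_|/forallPn[j]]; last by rewrite ffunE eqxx.
      by rewrite big1 ?mulr1// => j _; rewrite ffunE expr0.
    have rE (j : 'I_n) : ([ffun j => inord (j == i)] : {ffun 'I_n -> 'I_N.+2}) j
        = (j == i) :> nat by rewrite ffunE inordK//; case: (j == i).
    case: ifPn => [/forallP/(_ i)|_]; first by rewrite rE eqxx.
    case: ifPn => [_|/forallPn[j]]; last by rewrite rE eqxx.
    rewrite mul1r (bigD1 i)//= rE eqxx expr1 big1 ?mulr1// => j ji.
    by rewrite rE (negbTE ji) expr0.
  rewrite /power_term /c; case: ifPn => [/forallP r0|_].
    case/eqP: rN0; apply/ffunP => j; rewrite ffunE; apply/val_inj.
    exact/eqP/r0.
  case: ifPn => [/forallP ri|_]; last by rewrite mul0r.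
  case/eqP: rNi; apply/ffunP => j; rewrite ffunE; apply/val_inj => /=.
  by rewrite inordK ?(eqP (ri j))//; case: (j == i).
split.
  exists (\sum_(r : {ffun 'I_n -> 'I_0}) `|power_term c (y - x) r| +
    (\sum_(r : {ffun 'I_n -> 'I_1}) `|power_term c (y - x) r| +
    (`|x ord0 i| + `|(y - x) ord0 i|))).
  case=> [|[|N]]; last 1 first.
  - by rewrite (E _ Num.norm) ?normr0// ler_wpDl ?sumr_ge0// ler_wpDl ?sumr_ge0.
  - by rewrite lerDl !addr_ge0// sumr_ge0.
  - by rewrite ler_wpDl ?sumr_ge0// lerDl addr_ge0.
rewrite -cvg_shiftS -cvg_shiftS; apply: cvg_near_cst; apply: nearW => N /=.
by rewrite (E N id)//= !mxE subrKC.
Qed.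

Lemma real_analyticZD (a : R) f g :
  real_analytic f -> real_analytic g -> real_analytic (a *: f + g).
Proof.
move=> af ag x; have [c [e e0 fc]] := af x; have [d [e' e'0 gd]] := ag x.
exists (fun r => a * c r + d r), (Num.min e e'); first by rewrite lt_min e0.
move=> y xy.
have /fc[[C fC] fl] : ball x e y by apply: le_ball xy; rewrite ge_min lexx.
have /gd[[D gD] gl] : ball x e' y by apply: le_ball xy; rewrite ge_min lexx orbT.
have ptE N (r : {ffun 'I_n -> 'I_N}) : power_term (fun r => a * c r + d r) (y - x) r =
    a * power_term c (y - x) r + power_term d (y - x) r.
  by rewrite /power_term mulrDl mulrA.
split.
  exists (`|a| * C + D) => N.
  rewrite (le_trans _ (lerD (ler_wpM2l (normr_ge0 a) (fC N)) (gD N)))//.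
  rewrite mulr_sumr -big_split/= ler_sum// => r _.
  by rewrite ptE (le_trans (ler_normD _ _))// normrM.
under eq_fun do under eq_bigr do rewrite ptE.
under eq_fun do rewrite big_split/= -mulr_sumr.
by apply: cvgD => //; apply: cvgMr.
Qed.

Lemma analytic_submod : submod_closed analytic_pred.
Proof.
split=> [|a f g /analytic_predP af /analytic_predP ag]; apply/analytic_predP.
  exact: (real_analytic_cst 0).
exact: real_analyticZD.
Qed.

HB.instance Definition _ :=
  GRing.isSubmodClosed.Build R ('rV[R]_n -> R^o) analytic_pred analytic_submod.

End RealAnalytic.

Record Comega (R : realType) (n : nat) := MkComega {
  Comega_fun :> 'rV[R]_n -> R^o ;
  _ : Comega_fun \in @analytic_pred R n }.

HB.instance Definition _ (R : realType) (n : nat) :=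
  [isSub for @Comega_fun R n].
HB.instance Definition _ (R : realType) (n : nat) :=
  [Choice of Comega R n by <:].
HB.instance Definition _ (R : realType) (n : nat) :=
  [SubChoice_isSubLmodule of Comega R n by <:].

Definition coordinate (R : realType) (n : nat) (i : 'I_n) : Comega R n :=
  MkComega (introT (analytic_predP _) (@real_analytic_coord R n i)).

Definition LComega (R : realType) (n : nat) :=
  {linear Comega R n -> Comega R n}.

Section Derivations.
Variables (R : realType) (n : nat).

Definition partial (i : 'I_n) (f : 'rV[R]_n -> R^o) : 'rV[R]_n -> R^o :=
  fun x => 'D_(delta_mx ord0 i) f x.

Definition multi_partial (r : 'I_n -> nat) (f : 'rV[R]_n -> R^o) :
    'rV[R]_n -> R^o :=
  foldr (fun i g => iter (r i) (partial i) g) f (enum 'I_n).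

Definition Gamma_omega : set ('rV[R]_n -> 'rV[R]_n) :=
  [set V | forall i, real_analytic (fun x => V x ord0 i : R^o)].

Definition lie_derivative (V : 'rV[R]_n -> 'rV[R]_n) (f : 'rV[R]_n -> R^o) :
    'rV[R]_n -> R :=
  fun x => \sum_i V x ord0 i * partial i f x.

(* A is the derivation identified with V; as analytic functions are stable under
   lie_derivative V, every V in Gamma_omega has exactly one such A up to =1. *)
Definition is_derivation_of (V : 'rV[R]_n -> 'rV[R]_n) (A : LComega R n) :=
  forall (f : Comega R n) x, A f x = lie_derivative V f x.

Definition derivations (B : set ('rV[R]_n -> 'rV[R]_n)) : set (LComega R n) :=
  [set A | exists2 V, B V & is_derivation_of V A].

End Derivations.

Section OmegaTopology.
Variables (R : realType) (n : nat).
Implicit Types (K : set 'rV[R]_n) (a : R^nat) (f : Comega R n).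

Definition c0_decreasing a : Prop :=
  [/\ forall j, 0 < a j, decreasing_seq a & a @ \oo --> (0 : R)].

(* The maximum with 0 only matters for empty K. *)
Definition rho K a f (A : Comega R n -> Comega R n) : \bar R :=
  maxe 0%:E (ereal_sup [set y | exists x (r : 'I_n -> nat), K x /\
    y = ((\prod_(j < (\sum_i r i).+1) a j) / (\sum_i r i)`!%:R
           * `|multi_partial r (A f) x|)%:E]).

Definition omega_bounded (S : set (LComega R n)) : Prop :=
  forall K a f, compact K -> c0_decreasing a ->
    exists C : R, forall A : LComega R n, S A -> (rho K a f A <= C%:E)%E.

(* The simple curve u |-> \sum_j \1_(A_j) u L_j, with A_j measurable. *)
Record simple_curve := SimpleCurve {
  sc_size : nat ;
  sc_set : 'I_sc_size -> set R ;
  sc_val : 'I_sc_size -> LComega R n ;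
  sc_measurable : forall j, measurable (sc_set j) }.

Definition simple_eval (s : simple_curve) (u : R) :
    Comega R n -> Comega R n :=
  fun f => \sum_(j < sc_size s) (\1_(sc_set j) u : R) *: sc_val j f.

Definition simple_integral (s : simple_curve) (J : set R) :
    Comega R n -> Comega R n :=
  fun f => \sum_(j < sc_size s)
    fine (lebesgue_measure (sc_set j `&` J)) *: sc_val j f.

(* Bochner integral over a bounded interval J, for the locally convex topology
   generated by the seminorms rho; s is a net of simple curves along F. *)
Definition is_integral (J : set R) (c : R -> LComega R n) (I : LComega R n) :
    Prop :=
  exists (D : Type) (F : set_system D) (s : D -> simple_curve),
    ProperFilter F /\
    forall K a f, compact K -> c0_decreasing a ->
      let err d u := rho K a f (fun g => c u g - simple_eval (s d) u g) in
      [/\ forall d, measurable_fun J (err d),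
          (fun d => \int[lebesgue_measure]_(u in J) err d u)%E @ F --> 0%E &
          (fun d => rho K a f (fun g => I g - simple_integral (s d) J g))
            @ F --> 0%E].

End OmegaTopology.

Section Curves.
Variables (R : realType) (n : nat).
Implicit Types (T : R) (X E : R -> LComega R n).

(* s lists the break points: X is constant on subintervals that avoid them. *)
Definition piecewise_constant T X : Prop :=
  exists s : seq R, forall u v, 0 <= u -> u <= v -> v <= T ->
    (forall w, w \in s -> ~~ (u <= w <= v)) -> X u =1 X v.

Definition PC T (S : set (LComega R n)) : set (R -> LComega R n) :=
  [set X | piecewise_constant T X /\
    {ae @lebesgue_measure R, forall t, 0 <= t <= T -> S (X t)}].

Fixpoint is_flow_iteration T X (k : nat) E : Prop :=
  match k with
  | 0 => forall t, 0 <= t <= T -> forall f, E t f = f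
  | k'.+1 => exists2 E', is_flow_iteration T X k' E' &
      forall t, 0 <= t <= T -> exists2 I : LComega R n,
        is_integral `[0, t] (fun u => E' u \o X u : LComega R n) I &
        forall f, E t f = f + I f
  end.

Definition absolutely_continuous T (g : R -> 'rV[R]_n) : Prop :=
  forall e : R, 0 < e -> exists2 d : R, 0 < d &
    forall (m : nat) (u v : 'I_m -> R),
      (forall j, [/\ 0 <= u j, u j <= v j & v j <= T]) ->
      trivIset setT (fun j => `]u j, v j[%classic) ->
      \sum_j (v j - u j) < d -> \sum_j `|g (v j) - g (u j)| < e.

(* g t = exp(tX)(x0); X t is identified with a vector field for almost all t. *)
Definition is_flow T X (x0 : 'rV[R]_n) (g : R -> 'rV[R]_n) : Prop :=
  [/\ absolutely_continuous T g, g 0 = x0 &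
      {ae @lebesgue_measure R, forall t, 0 <= t <= T ->
        exists V, [/\ Gamma_omega V, is_derivation_of V (X t) &
                      is_derive t 1 g (V (g t))]}].

End Curves.

(* Main.v *)
From HB Require Import structures.
Require Import Defs.
From mathcomp Require Import ring lra.

(* Differentiating f along the flow g and integrating shows that the error
   e_k(t, f) = f(g t) - E_k(t) f (x0) is the integral over [0, t] of
   e_(k-1)(u, X(u) f); hence |e_k(t, x^i)| is at most t^(k+1) / (k+1)! times a
   bound for the (k+1)-fold products A_(k+1) .. A_1 x^i, with A_j in B, on a ball
   around x0 in which the flow stays.

   Boundedness in the C^omega-topology, tested against all sequences of
   c_0-decreasing weights, yields one M such that every component V of a field in
   B satisfies |d_w V| <= M^(|w|+1) |w|! on the ball.  The right-hand side is the
   majorant M / (1 - M s), so k+1 fields are majorised by iterating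
   n M / (1 - M s) d/ds, and A_(k+1) .. A_1 x^i is at most M (2 n M^2)^k k!.

   The flow exists by Picard iteration.  Integrating along an arbitrary solution
   relies on the fact that the increments of an absolutely continuous function are
   controlled by its derivative almost everywhere (ac_derive_bound). *)

Local Open Scope classical_set_scope.
Local Open Scope ring_scope.

(** * Norms of row vectors and quadratic bounds *)

(** Boundedness controls each weighted seminorm separately and names no common geometric rate for
    the Taylor coefficients. The growth [k!] rather than [(2 k)!] is what leaves a geometric series.
    A field costs one derivative and one product, so the exponent of the majorant rises by two, but
    only the derivative multiplies the constant by that exponent; the resulting factor is linear in
    the number of fields already applied. A further obstacle is that an operator-valued integral is
    given only as a limit along a net of simple curves. The seminorm at the single point [x0] turns
    such limits into limits of real integrals, where absolute values can be estimated. Since a curve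
    lies in [B] only almost everywhere, the work is done at regular times, where it is locally
    constant and hence in [B]. *)

Section row_norm.
Context {R : realType} {n : nat}.
Implicit Types h : 'rV[R]_n.

Lemma ler_coord_norm h i : `|h ord0 i| <= `|h|.
Proof.
rewrite /Num.norm/= mx_normrE.
exact: (@le_bigmax _ R _ 0 (fun ij => `|h ij.1 ij.2|) (ord0, i)).
Qed.

Lemma ler_row_norm h (a : R) : 0 <= a ->
  (forall i, `|h ord0 i| <= a) -> `|h| <= a.
Proof.
move=> a0 ha; rewrite /Num.norm/= mx_normrE; apply: bigmax_le => // -[j i] _ /=.
by rewrite (ord1 j).
Qed.

Lemma ltr_row_norm h (a : R) : 0 < a ->
  (forall i, `|h ord0 i| < a) -> `|h| < a.
Proof.
move=> a0 ha; rewrite /Num.norm/= mx_normrE; apply: bigmax_lt => // -[j i] _ /=.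
by rewrite (ord1 j).
Qed.

Lemma ball_row_norm (x y : 'rV[R]_n) e : ball x e y <-> `|y - x| < e.
Proof. by rewrite mx_norm_ball /ball_/= distrC. Qed.

Lemma norm_scale_delta (t : R) (i : 'I_n) :
  `|t *: delta_mx ord0 i : 'rV[R]_n| <= `|t|.
Proof.
apply: ler_row_norm => // j; rewrite !mxE eqxx/=.
by case: eqP => _; rewrite ?mulr1// mulr0 normr0.
Qed.

End row_norm.

Section quadratic_bounds.
Context {R : realType}.

Lemma limr_norm_le (u : nat -> R) (l C : R) :
  u @ \oo --> l -> (\forall N \near \oo, `|u N| <= C) -> `|l| <= C.
Proof.
move=> ul uC.
have cl : closed [set z : R | `|z| <= C].
  rewrite (_ : [set z : R | `|z| <= C] = (Num.norm : R -> R) @^-1` [set z | z <= C])//.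
  apply: closed_comp; last exact: closed_le.
  by move=> z _; exact: norm_continuous.
exact: (closed_cvg _ cl uC).
Qed.

(** Termwise differentiation. At a fixed small [t] every [d N] lies within [K * t] of the convergent
    quotient [t^-1 * (P N t - P N 0)], because the error bound is uniform in [N]; so [d] is Cauchy,
    and the quadratic bound passes to the limit. *)
Lemma cvg_difference_quotient (P : nat -> R -> R) (d : nat -> R) (F : R -> R)
    (K e : R) : 0 < e -> 0 <= K ->
  (forall t, `|t| < e -> P ^~ t @ \oo --> F t) ->
  (forall N t, `|t| < e -> `|P N t - P N 0 - t * d N| <= K * t ^+ 2) ->
  exists2 l : R, d @ \oo --> l &
    forall t, `|t| < e -> `|F t - F 0 - t * l| <= K * t ^+ 2.
Proof.
move=> e0 K0 PF Pd.
have cd : cvgn d.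
  apply/cauchy_cvgP; apply: cauchy_exP => eps eps0.
  pose t := Num.min (e / 2) (eps / (2 * (K + 1))).
  have t0 : 0 < t by rewrite lt_min !divr_gt0 ?mulr_gt0 ?ltr_wpDl.
  have te : `|t| < e by rewrite gtr0_norm// gt_min ltr_pdivrMr// ltr_pMr// ltr1n.
  have tK : t * K <= eps / 2.
    apply: (@le_trans _ _ (eps / (2 * (K + 1)) * (K + 1))).
      apply: ler_pM => //; [exact: ltW|by rewrite ge_min lexx orbT|].
      by rewrite lerDl.
    by rewrite invfM mulrA -mulrA mulVf ?mulr1// gt_eqF// ltr_wpDl.
  exists (t^-1 * (F t - F 0)).
  have PPF : t^-1 * (P N t - P N 0) @[N --> \oo] --> t^-1 * (F t - F 0).
    by apply: cvgMr; apply: cvgB; apply: PF; rewrite ?normr0.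
  have /cvgrPdist_lt/(_ (eps / 2)) := PPF.
  rewrite divr_gt0// => /(_ isT); apply: filterS => N /= H.
  rewrite /ball/=.
  have -> : t^-1 * (F t - F 0) - d N = (t^-1 * (F t - F 0) - t^-1 * (P N t - P N 0))
     + t^-1 * (P N t - P N 0 - t * d N).
     by rewrite [X in _ = _ + X]mulrBr mulrA mulVf ?gt_eqF// mul1r addrA subrK.
  rewrite (le_lt_trans (ler_normD _ _))// [ltRHS]splitr ltr_leD//.
  rewrite normrM normfV (gtr0_norm t0) mulrC ler_pdivrMr//.
  by rewrite (le_trans (Pd _ _ te))// expr2 mulrA ler_wpM2r ?(ltW t0)// mulrC.
exists (limn d) => // t te.
apply: (@limr_norm_le (fun N => P N t - P N 0 - t * d N)).
  apply: cvgB; last exact: cvgMr.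
  by apply: cvgB; apply: PF; rewrite ?normr0.
by apply: nearW => N; exact: Pd.
Qed.

Lemma is_derive_quadratic (V : normedModType R) (f : V -> R^o) (y v : V)
    (l K e : R) : 0 < e ->
  (forall t : R, `|t| < e -> `|f (y + t *: v) - f y - t * l| <= K * t ^+ 2) ->
  is_derive y v f l.
Proof.
move=> e0 fl.
suff H : h^-1 *: ((f \o shift y) (h *: v) - f y) @[h --> (0:R)^'] --> (l : R^o).
  by apply: DeriveDef; [apply/cvg_ex; exists (l : R^o)|apply/cvg_lim].
apply/cvgrPdist_lt => eps eps0.
have tb : \forall t \near (0:R)^', `|t| < e /\ `|t| * (`|K| + 1) < eps.
  have d0 : 0 < Num.min e (eps / (`|K| + 1)).
    by rewrite lt_min e0 divr_gt0// ltr_wpDl.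
  have := @dnbhs0_lt _ R _ d0; apply: filterS => t; rewrite lt_min => /andP[-> tK].
  by split => //; rewrite -ltr_pdivlMr// ltr_wpDl.
have t0 := @nbhs_dnbhs_neq R 0.
near=> t.
have tN0 : t != 0 by near: t; exact: t0.
have [te tK] : `|t| < e /\ `|t| * (`|K| + 1) < eps by near: t.
apply: le_lt_trans tK; rewrite distrC /= /GRing.scale/=.
have -> : t^-1 * (f (t *: v + y) - f y) - l
  = t^-1 * (f (y + t *: v) - f y - t * l).
  by rewrite [RHS]mulrBr mulrA mulVf// mul1r (addrC y).
rewrite normrM normfV mulrC ler_pdivrMr ?normr_gt0//.
rewrite (le_trans (fl _ te))// -(real_normK (num_real t)) expr2.
rewrite [leRHS]mulrAC mulrC ler_wpM2l ?mulr_ge0//.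
by rewrite (le_trans (ler_norm K))// lerDl.
Unshelve. all: by end_near. Qed.

End quadratic_bounds.

(** * Monomials *)

Section monomials.
Context {R : realType} {n : nat}.
Implicit Types (h x : 'rV[R]_n) (r : 'I_n -> nat) (i j : 'I_n) (t rho : R).

Definition monomial h r : R := \prod_i h ord0 i ^+ r i.

Definition degree r : nat := \sum_i r i.

Definition incr i r : 'I_n -> nat := fun j => (r j + (j == i))%N.

Definition decr i r : 'I_n -> nat := fun j => (r j - (j == i))%N.

(* The i-th partial derivative of a monomial; the truncated subtraction in decr
   is harmless because of the factor r i. *)
Definition dmonomial i h r : R := (r i)%:R * monomial h (decr i r).

Lemma incrK i : cancel (incr i) (decr i).
Proof. by move=> r; apply/funext => j; rewrite /decr /incr addnK. Qed.

Lemma decrK i r : (0 < r i)%N -> incr i (decr i r) = r.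
Proof.
move=> ri; apply/funext => j; rewrite /decr /incr subnK//.
by case: eqP => [->|].
Qed.

Lemma incrC i j r : incr i (incr j r) = incr j (incr i r).
Proof. by apply/funext => k; rewrite /incr addnAC. Qed.

Lemma degree_ge r i : (r i <= degree r)%N.
Proof. by rewrite /degree (bigD1 i)//= leq_addr. Qed.

Lemma degree_incr i r : degree (incr i r) = (degree r).+1.
Proof.
rewrite /degree /incr big_split/= -addn1; congr (_ + _)%N.
by rewrite (bigD1 i)//= eqxx big1 ?addn0// => j /negbTE ->.
Qed.

Lemma degree_decr i r : (0 < r i)%N -> degree (decr i r) = (degree r).-1.
Proof. by move=> ri; rewrite -[in RHS](decrK ri) degree_incr. Qed.

Lemma monomial_le h r rho : `|h| <= rho -> `|monomial h r| <= rho ^+ degree r.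
Proof.
move=> hr; rewrite normr_prod /degree expr_sum ler_prod// => i _.
by rewrite normr_ge0 normrX lerXn2r ?nnegrE// ?(le_trans (ler_coord_norm h i) hr)//
  (le_trans _ hr).
Qed.

Lemma dmonomial_incr i h r : dmonomial i h (incr i r) = (r i).+1%:R * monomial h r.
Proof. by rewrite /dmonomial incrK /incr eqxx addn1. Qed.

(** The factor [s ^+ 2] on the left replaces an exponent [m - 2] on the right, so [m < 2] and
    [s = 0] are covered. The induction closes because [m ^ 2 + m <= (m + 1) ^ 2]. *)
Lemma expr_quadratic (a t s : R) m : `|a| <= s -> `|a + t| <= s ->
  s ^+ 2 * `|(a + t) ^+ m - a ^+ m - t * (m%:R * a ^+ m.-1)|
    <= t ^+ 2 * m%:R ^+ 2 * s ^+ m.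
Proof.
move=> ha hat; have s0 : 0 <= s by rewrite (le_trans _ ha).
elim: m => [|m IH]; first by rewrite !expr0 mul0r mulr0 subrr subr0 normr0 mulr0
  expr0n mulr0 mul0r.
have -> : (a + t) ^+ m.+1 - a ^+ m.+1 - t * (m.+1%:R * a ^+ m.+1.-1) =
    (a + t) * ((a + t) ^+ m - a ^+ m - t * (m%:R * a ^+ m.-1))
    + t ^+ 2 * (m%:R * a ^+ m.-1).
  by case: m {IH} => [|m]; rewrite /= ?expr0 ?expr1 ?exprS -?natr1; ring.
apply: (@le_trans _ _ (s * (t ^+ 2 * m%:R ^+ 2 * s ^+ m)
   + t ^+ 2 * (m%:R * s ^+ m.+1))).
  rewrite (le_trans (ler_wpM2l _ (ler_normD _ _))) ?exprn_ge0// mulrDr lerD//.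
    by rewrite normrM mulrCA ler_pM ?mulr_ge0 ?exprn_ge0.
  rewrite normrM (ger0_norm (sqr_ge0 t)) mulrCA ler_wpM2l ?sqr_ge0//.
  rewrite normrM normr_nat mulrCA.
  case: m {IH} => [|m]; first by rewrite !mul0r.
  rewrite ler_wpM2l//.
  by rewrite -[in leRHS]addn2 addnC exprD ler_wpM2l ?exprn_ge0//= normrX lerXn2r
    ?nnegrE.
have sm : 0 <= s ^+ m by exact: exprn_ge0.
rewrite [leLHS](_ : _ = t ^+ 2 * (m%:R ^+ 2 + m%:R) * s ^+ m.+1);
  last by rewrite [s ^+ m.+1]exprS; ring.
rewrite ler_wpM2r ?exprn_ge0// ler_wpM2l ?sqr_ge0// -natr1.
have : 0 <= m%:R :> R by [].
nra.
Qed.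

Lemma monomial_delta i h r t : monomial (h + t *: delta_mx ord0 i) r
  = (h ord0 i + t) ^+ r i * \prod_(j | j != i) h ord0 j ^+ r j.
Proof.
rewrite /monomial (bigD1 i)//= !mxE !eqxx mulr1; congr (_ * _).
by apply: eq_bigr => j /negbTE ji; rewrite !mxE eqxx ji mulr0 addr0.
Qed.

Lemma dmonomialE i h r : dmonomial i h r
  = (r i)%:R * h ord0 i ^+ (r i).-1 * \prod_(j | j != i) h ord0 j ^+ r j.
Proof.
rewrite /dmonomial /monomial (bigD1 i)//= /decr eqxx subn1 mulrA; congr (_ * _).
by apply: eq_bigr => j /negbTE ->; rewrite subn0.
Qed.

Lemma monomial_quadratic i h r t (s : R) : `|h| <= s ->
    `|h + t *: delta_mx ord0 i| <= s ->
  s ^+ 2 * `|monomial (h + t *: delta_mx ord0 i) r - monomial h r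
             - t * dmonomial i h r|
    <= t ^+ 2 * (r i)%:R ^+ 2 * s ^+ degree r.
Proof.
move=> hs hts; have s0 : 0 <= s by rewrite (le_trans _ hs).
rewrite -[X in _ - monomial X r](addr0 h) -(scale0r (delta_mx ord0 i)).
rewrite !monomial_delta dmonomialE addr0; set p := \prod_(j | _) _.
rewrite (mulrA t) -!mulrBl normrM [leLHS]mulrA.
have -> : s ^+ degree r = s ^+ r i * \prod_(j | j != i) s ^+ r j.
  by rewrite /degree expr_sum (bigD1 i).
rewrite [leRHS]mulrA; apply: ler_pM; rewrite ?mulr_ge0 ?exprn_ge0//.
  apply: expr_quadratic; first exact: le_trans (ler_coord_norm _ _) hs.
  by have := le_trans (ler_coord_norm _ i) hts; rewrite !mxE !eqxx mulr1.
rewrite /p normr_prod ler_prod// => j _; rewrite normr_ge0 normrX lerXn2r ?nnegrE//.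
exact: le_trans (ler_coord_norm _ _) hs.
Qed.

Lemma sqr_degree_le r i : ((r i) ^ 2 <= 4 ^ degree r)%N.
Proof.
rewrite (_ : 4 = 2 ^ 2)%N// -expnM mulnC expnM leq_sqr.
by rewrite (leq_trans (degree_ge r i))// ltnW// ltn_expl.
Qed.

(** Shrinking the radius by 8 gains [8 ^ degree r]: a factor [2 ^ degree r] pays for [r i], and the
    remaining [4 ^ degree r] is the decay that [expands_partial] needs on the boundary of the
    cubes. *)
Lemma deriv_weight r i rho : 0 < rho ->
  (r i)%:R * (rho / 8) ^+ (degree r).-1
    <= 8 / rho * 4^-1 ^+ degree r * rho ^+ degree r.
Proof.
move=> rho0; have := degree_ge r i; case: (degree r) => [|m] rm.
  move: rm; rewrite leqn0 => /eqP ->; rewrite mul0r expr0 mulr1 mulr1.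
  by rewrite divr_ge0 ?(ltW rho0).
rewrite /= exprMn !exprVn [leRHS](_ : _ = 2 * 2 ^+ m * (rho ^+ m * 8 ^- m)).
  rewrite ler_wpM2r//; first by rewrite mulr_ge0 ?invr_ge0 ?exprn_ge0 ?(ltW rho0).
  by rewrite -exprS -natrX ler_nat (leq_trans rm)// ltnW// ltn_expl.
rewrite (_ : 8 = 2 * 4); last by rewrite -natrM.
rewrite exprMn invfM !exprS; field.
by rewrite !expf_neq0 ?pnatr_eq0//= gt_eqF.
Qed.

End monomials.

(** * Power series summed over cubes *)

Section cube_sums.
Context {R : realType} {n : nat}.
Implicit Types (h x : 'rV[R]_n) (r : 'I_n -> nat) (i j : 'I_n) (t rho C : R).
Implicit Types (F G : ('I_n -> nat) -> R).

Definition cube_sum N F : R :=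
  \sum_(r : {ffun 'I_n -> 'I_N}) F (fun i => r i : nat).

Lemma cube_sumB N F G :
  cube_sum N F - cube_sum N G = cube_sum N (fun r => F r - G r).
Proof. by rewrite /cube_sum -sumrB. Qed.

Lemma cube_sumZ N a F : a * cube_sum N F = cube_sum N (fun r => a * F r).
Proof. by rewrite /cube_sum mulr_sumr. Qed.

Lemma ler_cube_sum N F G : (forall r, F r <= G r) -> cube_sum N F <= cube_sum N G.
Proof. by move=> FG; apply: ler_sum => r _. Qed.

Lemma ler_norm_cube_sum N F G : (forall r, `|F r| <= G r) ->
  `|cube_sum N F| <= cube_sum N G.
Proof. by move=> FG; rewrite (le_trans (ler_norm_sum _ _ _))// ler_sum. Qed.

Let incr_ffun N i (r : {ffun 'I_n -> 'I_N}) : {ffun 'I_n -> 'I_N.+1} :=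
  [ffun j => inord (r j + (j == i))].

Let incr_ffunE N i (r : {ffun 'I_n -> 'I_N}) :
  (fun j => incr_ffun i r j : nat) = incr i (fun j => r j : nat).
Proof.
apply/funext => j; rewrite ffunE inordK// ltnS.
by case: eqP => _; rewrite ?addn1 ?addn0// ltnW.
Qed.

Let incr_ffun_inj N i : injective (@incr_ffun N i).
Proof.
move=> r1 r2 E; have := congr1 (fun (r : {ffun 'I_n -> 'I_N.+1}) (j : 'I_n) => r j
  : nat) E.
rewrite !incr_ffunE => /(can_inj (@incrK n i)) E'.
by apply/ffunP => j; apply/val_inj; exact: (congr1 (@^~ j) E').
Qed.

Let cube_sum_incrE N i G : cube_sum N (G \o incr i) =
  \sum_(r in [set incr_ffun i r | r in {: {ffun 'I_n -> 'I_N}}]%SET)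
    G (fun j => r j : nat).
Proof.
rewrite big_imset/=; last by move=> r1 r2 _ _; exact: incr_ffun_inj.
by rewrite /cube_sum; apply: eq_bigr => r _; rewrite incr_ffunE.
Qed.

Lemma cube_sum_incr_le N i G : (forall r, 0 <= G r) ->
  cube_sum N (G \o incr i) <= cube_sum N.+1 G.
Proof.
move=> G0; rewrite cube_sum_incrE [leRHS]/cube_sum.
rewrite [leRHS](bigID [in [set incr_ffun i r | r in {: {ffun 'I_n -> 'I_N}}]%SET])/=.
by rewrite lerDl sumr_ge0.
Qed.

(** Shifting by [incr i] embeds the cube of side [N] into the next one. It misses indices with
    [r i = 0], where [G] vanishes, and indices with a coordinate equal to [N], which the right-hand
    side collects. *)
Lemma cube_sum_incr N i G : (forall r, r i = 0%N -> G r = 0) ->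
  `|cube_sum N.+1 G - cube_sum N (G \o incr i)| <=
  \sum_(r : {ffun 'I_n -> 'I_N.+1} | [exists j, r j == N :> nat])
    `|G (fun j => r j : nat)|.
Proof.
move=> G0; rewrite cube_sum_incrE [X in `|X - _|]/cube_sum.
set S := [set incr_ffun i r | r in {: {ffun 'I_n -> 'I_N}}]%SET.
rewrite [X in `|X - _|](bigID [in S])/= addrAC subrr add0r.
rewrite (le_trans (ler_norm_sum _ _ _))//.
rewrite big_mkcond [leRHS]big_mkcond/=; apply: ler_sum => r _.
case: ifPn => rS; last by case: ifP.
case: ifPn => // /existsPn rN.
have [ri|ri] := posnP (r i); first by rewrite G0// normr0.
have rlt (j : 'I_n) : (r j - (j == i) < N)%N.
  by rewrite (leq_ltn_trans (leq_subr _ _))// ltn_neqAle rN -ltnS ltn_ord.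
case/negP: rS; apply/imsetP; exists [ffun j => Ordinal (rlt j)] => //.
apply/ffunP => j; apply/val_inj; rewrite ffunE /= inordK ffunE/=.
  by rewrite subnK//; case: eqP => [->|].
rewrite ltnS; case: eqP (rlt j) => [->|_]; last by rewrite subn0 addn0; exact: ltnW.
by rewrite addn1.
Qed.

Definition power_sum (c : ('I_n -> nat) -> R) h (N : nat) : R :=
  cube_sum N (fun r => c r * monomial h r).

(** Unlike in [real_analytic], absolute convergence is required once, at a full radius, and thereby
    bounds the coefficients themselves. *)
Definition expands (f : 'rV[R]_n -> R^o) x (c : ('I_n -> nat) -> R) : Prop :=
  exists rho C, [/\ 0 < rho,
    forall N, cube_sum N (fun r => `|c r| * rho ^+ degree r) <= C &
    forall h, `|h| < rho -> power_sum c h @ \oo --> (f (x + h) : R)].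

Lemma real_analytic_expands f x : real_analytic f -> exists c, expands f x c.
Proof.
move=> /(_ x)[c [e e0 fc]]; exists c, (e / 2).
have e20 : 0 < e / 2 by rewrite divr_gt0.
have e2 : e / 2 < e by rewrite ltr_pdivrMr// ltr_pMr// ltr1n.
(* At the increment with all coordinates [e / 2], the monomial of [r] is exactly
   [(e / 2) ^+ degree r]. *)
have [|[C HC] _] := fc (x + const_mx (e / 2)).
  apply/ball_row_norm; rewrite addrAC subrr add0r ltr_row_norm// => i.
  by rewrite mxE gtr0_norm.
exists C; split => // [N|h he].
  rewrite (le_trans _ (HC N))//; apply: ler_sum => r _.
  rewrite /power_term normrM normr_prod /degree expr_sum ler_wpM2l//.
  apply: ler_prod => i _; rewrite exprn_ge0 ?(ltW e20)//=.
  by rewrite addrAC subrr add0r mxE normrX gtr0_norm.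
have [|_] := fc (x + h).
  by apply/ball_row_norm; rewrite addrAC subrr add0r (lt_trans he).
by rewrite addrAC subrr add0r.
Qed.

Lemma expands_real_analytic f : (forall x, exists c, expands f x c) ->
  real_analytic f.
Proof.
move=> fc x; have [c [rho [C [rho0 HC cf]]]] := fc x.
exists c, rho => // y /ball_row_norm yx; split.
  exists C => N; rewrite (le_trans _ (HC N))//; apply: ler_sum => r _.
  rewrite normrM ler_wpM2l//; exact: (monomial_le (fun i => r i : nat) (ltW yx)).
by have := cf _ yx; rewrite subrKC.
Qed.

Lemma degree0 : degree (fun _ : 'I_n => 0%N) = 0%N.
Proof. by rewrite /degree big1. Qed.

Lemma monomial0 r : monomial (0 : 'rV[R]_n) r = (degree r == 0%N)%:R.
Proof.
have [/eqP r0|] := boolP (degree r == 0%N).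
  rewrite /monomial big1// => i _; have := degree_ge r i.
  by rewrite r0 leqn0 => /eqP ->; rewrite expr0.
rewrite /degree sum_nat_eq0 => /forallPn[i]; rewrite implyTb => ri.
by rewrite /monomial (bigD1 i)//= mxE expr0n (negbTE ri) mul0r.
Qed.

Lemma expands_center f x c : expands f x c -> f x = c (fun=> 0%N).
Proof.
move=> [rho [C [rho0 _ /(_ 0)]]]; rewrite normr0 addr0 => /(_ rho0) cf.
have : power_sum c 0 @ \oo --> (c (fun=> 0%N)).
  apply: cvg_near_cst; apply: filterS (nbhs_infty_gt 0) => -[|N] // _.
  rewrite /power_sum /cube_sum (bigD1 [ffun=> ord0])//=.
  have E : (fun i => ([ffun=> ord0] : {ffun 'I_n -> 'I_N.+1}) i : nat) = fun=> 0%N.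
    by apply/funext => i; rewrite ffunE.
  rewrite E monomial0 degree0 eqxx mulr1 big1 ?addr0// => r rN0.
  rewrite monomial0; case: eqP => [r0|]; last by rewrite mulr0.
  case/eqP: rN0; apply/ffunP => i; apply/val_inj; rewrite ffunE/=.
  by apply/eqP; rewrite -leqn0 -r0 (degree_ge (fun i => r i : nat)).
by apply: cvg_unique cf => //.
Qed.

End cube_sums.

(** * Calculus of real analytic functions *)

Section analytic_calculus.
Context {R : realType} {n : nat}.
Implicit Types (f : 'rV[R]_n -> R^o) (h x : 'rV[R]_n) (r : 'I_n -> nat).
Implicit Types (c : ('I_n -> nat) -> R) (i j : 'I_n).

Definition deriv_coef i c : ('I_n -> nat) -> R :=
  fun r => (r i).+1%:R * c (incr i r).

Lemma expands_cvg_partial f x c i : expands f x c ->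
  exists2 rho : R, 0 < rho & forall h, `|h| < rho ->
    derivable f (x + h) (delta_mx ord0 i) /\
    cube_sum N (fun r => c r * dmonomial i h r) @[N --> \oo]
      --> (partial i f (x + h) : R).
Proof.
move=> [rho [C [rho0 HC cf]]]; exists (rho / 8); first by rewrite divr_gt0.
(* Increments [h] and [t] below [rho / 8] stay within [s]. The remainder of a monomial costs
   [(r i) ^ 2 <= 4 ^ degree r], which is the ratio of [rho ^+ degree r] to [s ^+ degree r]. *)
move=> h hrho; pose s := rho / 4; have s0 : 0 < s by rewrite divr_gt0.
pose d N := cube_sum N (fun r => c r * dmonomial i h r).
pose P N t := power_sum c (h + t *: delta_mx ord0 i) N.
have hts t : `|t| < rho / 8 -> `|h + t *: delta_mx ord0 i| < s.
  move=> trho; rewrite (le_lt_trans (ler_normD _ _))//.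
  rewrite (@lt_le_trans _ _ (rho / 8 + rho / 8))//; last by rewrite /s; lra.
  by rewrite ltr_leD// ltW// (le_lt_trans (norm_scale_delta _ _)).
have C0 : 0 <= C.
  by rewrite (le_trans _ (HC 0%N))// sumr_ge0// => r _;
    rewrite mulr_ge0 ?exprn_ge0// ltW.
have [] := @cvg_difference_quotient R P d
   (fun t => f (x + (h + t *: delta_mx ord0 i))) (C / s ^+ 2) (rho / 8).
- by rewrite divr_gt0.
- by rewrite divr_ge0// sqr_ge0.
- move=> t /hts ts; apply: cf; rewrite (lt_trans ts)// /s; lra.
- move=> N t /hts ts; rewrite /P /d /power_sum scale0r addr0 cube_sumZ !cube_sumB.
  rewrite mulrAC ler_pdivlMr ?exprn_gt0//.
  rewrite -[s ^+ 2]ger0_norm ?sqr_ge0// -normrM mulrC cube_sumZ.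
  rewrite (le_trans (@ler_norm_cube_sum _ _ _ _
      (fun r => t ^+ 2 * (`|c r| * rho ^+ degree r)) _))//.
    move=> r; rewrite [X in s ^+ 2 * X](_ : _ = c r *
      (monomial (h + t *: delta_mx ord0 i) r - monomial h r - t * dmonomial i h r));
        last by ring.
    rewrite mulrCA normrM [leRHS]mulrCA ler_wpM2l// normrM (ger0_norm (sqr_ge0 s)).
    rewrite (le_trans (monomial_quadratic _ _ (ltW ts)))//.
      by rewrite ltW// (lt_trans hrho)// /s; lra.
    rewrite -mulrA ler_wpM2l ?sqr_ge0// exprMn mulrCA ler_piMr ?exprn_ge0 ?(ltW rho0)//.
    rewrite exprVn ler_pdivrMr ?exprn_gt0// mul1r -!natrX ler_nat.
    exact: sqr_degree_le.
  by rewrite -cube_sumZ mulrC ler_wpM2r ?sqr_ge0.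
move=> l dl fl.
have [] := @is_derive_quadratic R _ f (x + h) (delta_mx ord0 i) l (C / s ^+ 2) (rho
  / 8).
- by rewrite divr_gt0.
- by move=> t /fl; rewrite scale0r addr0 !addrA.
by move=> df; rewrite /partial => ->.
Qed.

Lemma expands_derivable f x c i : expands f x c ->
  derivable f x (delta_mx ord0 i).
Proof.
move=> /(expands_cvg_partial i)[rho rho0 /(_ 0)].
by rewrite normr0 addr0 => /(_ rho0)[].
Qed.

(** The derived series is the termwise derivative shifted by [incr i], so its cube sums are not
    those of the termwise derivative. They differ only by terms with an index equal to [N], whose
    degree is at least [N], and [deriv_weight] makes these at most a multiple of [4 ^ -N]. *)
Lemma expands_partial f x c i : expands f x c ->
  expands (partial i f) x (deriv_coef i c).
Proof.
move=> fc; have [rho' rho'0 df] := expands_cvg_partial i fc.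
have [rho [C [rho0 HC cf]]] := fc.
have C0 : 0 <= C.
  by rewrite (le_trans _ (HC 0%N))// sumr_ge0// => r _;
    rewrite mulr_ge0 ?exprn_ge0// ltW.
have s0 : 0 < rho / 8 by rewrite divr_gt0.
have ws r : (r i)%:R * (rho / 8) ^+ (degree r).-1
    <= 8 / rho * 4^-1 ^+ degree r * rho ^+ degree r by exact: deriv_weight.
exists (Num.min rho' (rho / 8)), (8 / rho * C); split.
- by rewrite lt_min rho'0.
- move=> N; pose G r := (r i)%:R * (`|c r| * (rho / 8) ^+ (degree r).-1).
  apply: (@le_trans _ _ (cube_sum N (G \o incr i))).
    apply: ler_cube_sum => r /=; rewrite /G degree_incr /= /incr eqxx addn1.
    rewrite normrM normr_nat -mulrA !ler_wpM2l// lerXn2r ?nnegrE ?(ltW s0)//.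
      by rewrite le_min !ltW.
    by rewrite ge_min lexx orbT.
  apply: le_trans (cube_sum_incr_le N _ _) _.
    by move=> r; rewrite !mulr_ge0 ?exprn_ge0// ltW.
  apply: (@le_trans _ _ (8 / rho * cube_sum N.+1 (fun r => `|c r| * rho ^+ degree r))).
    rewrite cube_sumZ; apply: ler_cube_sum => r; rewrite /G mulrCA [leRHS]mulrCA.
    rewrite ler_wpM2l// (le_trans (ws r))// ler_wpM2r ?exprn_ge0 ?(ltW rho0)//.
    rewrite ler_piMr ?divr_ge0 ?(ltW rho0)// exprn_ile1 ?invr_ge0//.
    by rewrite invf_le1// ler1n.
  by rewrite ler_wpM2l// divr_ge0// ltW.
- move=> h; rewrite lt_min => /andP[hr' hr].
  have [_ dfh] := df h hr'.
  pose G r := c r * dmonomial i h r.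
  have Gle r : `|G r| <= 8 / rho * 4^-1 ^+ degree r * (`|c r| * rho ^+ degree r).
    rewrite normrM [leRHS]mulrCA ler_wpM2l// normrM normr_nat.
    have [ri|ri] := posnP (r i).
      by rewrite ri mul0r mulr_ge0 ?exprn_ge0// ?mulr_ge0 ?invr_ge0 ?exprn_ge0
        ?(ltW rho0).
    apply: le_trans (ws r); rewrite ler_wpM2l// -(degree_decr ri).
    exact: monomial_le (ltW hr).
  have dcG N : power_sum (deriv_coef i c) h N = cube_sum N (G \o incr i).
    apply: eq_bigr => r _ /=; rewrite /G dmonomial_incr /deriv_coef; ring.
  have dN N : `|cube_sum N.+1 G - power_sum (deriv_coef i c) h N|
      <= 8 / rho * C * 4^-1 ^+ N.
    rewrite dcG (le_trans (cube_sum_incr _ _))//.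
      by move=> r ri; rewrite /G /dmonomial ri mul0r mulr0.
    rewrite big_mkcond/= (@le_trans _ _ (8 / rho * 4^-1 ^+ N * cube_sum N.+1
        (fun r => `|c r| * rho ^+ degree r)))//.
      rewrite cube_sumZ; apply: ler_sum => r _.
      case: ifPn => [/existsP[j /eqP rj]|_]; last first.
        by rewrite !mulr_ge0 ?invr_ge0 ?exprn_ge0 ?invr_ge0 ?(ltW rho0).
      rewrite (le_trans (Gle _))// ler_wpM2r//.
        by rewrite mulr_ge0 ?exprn_ge0 ?(ltW rho0).
      rewrite ler_wpM2l ?divr_ge0 ?(ltW rho0)// ler_wiXn2l ?invr_ge0//.
        by rewrite invf_le1// ler1n.
      by rewrite -[leqLHS]rj (degree_ge (fun j => r j : nat)).
    by rewrite mulrAC ler_wpM2r ?exprn_ge0 ?invr_ge0// ler_wpM2l// divr_ge0// ltW.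
  have d0 : cube_sum N.+1 G - power_sum (deriv_coef i c) h N @[N --> \oo] --> (0 : R).
    apply: (@norm_cvg0 _ R).
    apply: (@squeeze_cvgr _ _ _ _ (fun=> 0) (fun N => 8 / rho * C * 4^-1 ^+ N)).
    - by apply: nearW => N /=; rewrite normr_ge0 dN.
    - exact: cvg_cst.
    - rewrite -[X in _ --> X](mulr0 (8 / rho * C)); apply: cvgMr.
      by apply: cvg_expr; rewrite ger0_norm ?invr_ge0// invf_lt1// ltr1n.
  have dfS : cube_sum N.+1 G @[N --> \oo] --> (partial i f (x + h) : R).
    by rewrite (cvg_shiftS (cube_sum^~ G)).
  rewrite (_ : power_sum (deriv_coef i c) h = fun N => cube_sum N.+1 G -
    (cube_sum N.+1 G - power_sum (deriv_coef i c) h N)); last first.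
    by apply/funext => N; rewrite opprB addrC subrK.
  by rewrite -[X in _ --> X]subr0; exact: cvgB.
Qed.

Lemma real_analytic_derivable f x i : real_analytic f ->
  derivable f x (delta_mx ord0 i).
Proof. by move=> /(real_analytic_expands x)[c fc]; exact: expands_derivable fc. Qed.

Lemma real_analytic_partial f i : real_analytic f -> real_analytic (partial i f).
Proof.
move=> af; apply: expands_real_analytic => x.
have [c fc] := real_analytic_expands x af.
by exists (deriv_coef i c); exact: expands_partial.
Qed.

(** Both sides at [x] are constant coefficients of twice derived expansions, so the symmetry is that
    of [incr]. *)
Lemma partialC f i j : real_analytic f ->
  partial i (partial j f) = partial j (partial i f).
Proof.
move=> af; apply/funext => x; have [c fc] := real_analytic_expands x af.
rewrite (expands_center (expands_partial i (expands_partial j fc))).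
rewrite (expands_center (expands_partial j (expands_partial i fc))).
rewrite /deriv_coef (incrC i j) /incr/= eq_sym.
by case: eqP => [->|_]; [|ring].
Qed.

(** The Taylor polynomial of degree one of the monomial at 0, written with [dmonomial] because those
    terms sum to the partial derivatives at the centre. *)
Let affine_part h r : R :=
  monomial (0 : 'rV[R]_n) r + \sum_i h ord0 i * dmonomial i 0 r.

Let monomial_affine h r (s : R) : `|h| <= s ->
  s ^+ 2 * `|monomial h r - affine_part h r| <= `|h| ^+ 2 * s ^+ degree r.
Proof.
move=> hs; have s0 : 0 <= s by rewrite (le_trans _ hs).
have lin : \sum_i h ord0 i * dmonomial i 0 r
    = (degree r == 1%N)%:R * \sum_i h ord0 i * (r i)%:R.
  rewrite mulr_sumr; apply: eq_bigr => i _; rewrite /dmonomial monomial0.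
  have [ri|ri] := posnP (r i); first by rewrite ri mul0r !mulr0.
  rewrite degree_decr// (_ : ((degree r).-1 == 0%N) = (degree r == 1%N)); first by ring.
  by case: (degree r) (leq_trans ri (degree_ge r i)) => [|[]].
rewrite /affine_part lin monomial0.
case D : (degree r) => [|[|m]]/=.
- rewrite mul0r addr0 (_ : monomial h r = 1) ?subrr ?normr0 ?mulr0; last first.
    rewrite /monomial big1// => i _; have := degree_ge r i.
    by rewrite D leqn0 => /eqP ->; rewrite expr0.
  by rewrite mulr_ge0 ?sqr_ge0 ?exprn_ge0.
- have [k rk] : exists k, (0 < r k)%N.
    apply: contrapT => /forallNP r0; move: D; rewrite /degree big1// => i _.
    by apply/eqP; rewrite -leqn0 leqNgt; apply/negP/r0.
  have dk : degree (decr k r) = 0%N by rewrite degree_decr// D.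
  have rE i : r i = (i == k).
    rewrite -(decrK rk) /incr (_ : decr k r i = 0%N)//.
    by apply/eqP; rewrite -leqn0 -dk degree_ge.
  have -> : monomial h r = h ord0 k.
    rewrite /monomial (bigD1 k)//= rE eqxx expr1 big1 ?mulr1// => i /negbTE ik.
    by rewrite rE ik expr0.
  rewrite (bigD1 k)//= rE eqxx mulr1 big1 => [|i /negbTE ik];
    last by rewrite rE ik mulr0.
  by rewrite addr0 mul1r add0r subrr normr0 mulr0 mulr_ge0 ?sqr_ge0 ?exprn_ge0.
- rewrite mul0r addr0 subr0 (_ : s ^+ m.+2 = s ^+ 2 * s ^+ m); last by rewrite -exprD.
  rewrite mulrCA ler_wpM2l ?sqr_ge0// (le_trans (monomial_le r (lexx _)))// D.
  rewrite (_ : `|h| ^+ m.+2 = `|h| ^+ 2 * `|h| ^+ m); last by rewrite -exprD.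
  by rewrite ler_wpM2l ?sqr_ge0// lerXn2r ?nnegrE.
Qed.

(** The bound holds for all directions at once, not just along the axes; this gives full
    differentiability and hence the chain rule along curves. *)
Lemma real_analytic_affine f x : real_analytic f ->
  exists K e : R, [/\ 0 < e, 0 <= K & forall h, `|h| < e ->
    `|f (x + h) - f x - \sum_i h ord0 i * partial i f x| <= K * `|h| ^+ 2].
Proof.
move=> /(real_analytic_expands x)[c fc].
have [rho [C [rho0 HC cf]]] := fc.
have C0 : 0 <= C.
  by rewrite (le_trans _ (HC 0%N))// sumr_ge0// => r _;
    rewrite mulr_ge0 ?exprn_ge0// ltW.
exists (C / rho ^+ 2), rho; split => //; first by rewrite divr_ge0 ?sqr_ge0.
move=> h hrho; pose D i N := cube_sum N (fun r => c r * dmonomial i 0 r).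
pose u N := power_sum c h N - power_sum c 0 N - \sum_i h ord0 i * D i N.
apply: (@limr_norm_le _ u).
  apply: cvgB; first apply: cvgB.
  - exact: cf.
  - by have := cf 0; rewrite normr0 addr0; exact.
  - apply: cvg_big; first exact: add_continuous.
    move=> i _; apply: cvgMr.
    have [rho' rho'0 /(_ 0)] := expands_cvg_partial i fc.
    by rewrite normr0 addr0 => /(_ rho'0)[].
apply: nearW => N; rewrite mulrAC ler_pdivlMr ?exprn_gt0//.
rewrite -[rho ^+ 2]ger0_norm ?sqr_ge0// -normrM mulrC.
have -> : u N = cube_sum N (fun r => c r * (monomial h r - affine_part h r)).
  rewrite /u /power_sum cube_sumB /D.
  under eq_bigr do rewrite cube_sumZ.
  rewrite /cube_sum exchange_big/= -sumrB; apply: eq_bigr => r _.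
  rewrite /affine_part mulrBr mulrDr mulr_sumr opprD addrA; congr (_ - _).
  by apply: eq_bigr => i _; rewrite mulrCA.
rewrite cube_sumZ (le_trans (@ler_norm_cube_sum _ _ _ _
    (fun r => `|h| ^+ 2 * (`|c r| * rho ^+ degree r)) _))//.
  move=> r; rewrite mulrCA normrM [leRHS]mulrCA ler_wpM2l//.
  by rewrite normrM ger0_norm ?sqr_ge0// monomial_affine// ltW.
by rewrite -cube_sumZ mulrC ler_wpM2r ?sqr_ge0.
Qed.

End analytic_calculus.

(** * Total differential, chain rule and Lipschitz bounds *)

Section linear_form.
Context {R : realType} {n : nat}.
Implicit Types (a : 'I_n -> R) (h : 'rV[R]_n).

Definition linear_form a : 'rV[R]_n -> R^o := fun h => \sum_i h ord0 i * a i.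

Lemma linear_form_is_linear a : linear (linear_form a).
Proof.
move=> k u v; rewrite /linear_form scaler_sumr -big_split/=.
by apply: eq_bigr => i _; rewrite !mxE mulrDl /GRing.scale/= mulrA.
Qed.

HB.instance Definition _ a :=
  GRing.isLinear.Build R 'rV[R]_n R^o _ (linear_form a) (linear_form_is_linear a).

Lemma linear_form_continuous a : continuous (linear_form a).
Proof.
apply: continuous_big => [|i _ h]; first exact: add_continuous.
apply: (@continuousM _ _ (fun h => h ord0 i) (fun=> a i)).
  exact: coord_continuous.
exact: cst_continuous.
Qed.

End linear_form.

Section analytic_differentiable.
Context {R : realType} {n : nat}.
Implicit Types (f : 'rV[R]_n -> R^o) (x v h : 'rV[R]_n).

Lemma real_analytic_diff f x : real_analytic f ->
  differentiable f x /\ ('d f x : 'rV[R]_n -> R^o) =1 linear_form (fun i => partial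
    i f x).
Proof.
move=> af; have [K [e [e0 K0 fK]]] := real_analytic_affine x af.
set df := linear_form _.
have fdf : f \o shift x = cst (f x) + df +o_ (0 : 'rV[R]_n) id.
  apply/eqaddoP => eps eps0.
  have d0 : 0 < Num.min e (eps / (K + 1)) by rewrite lt_min e0 divr_gt0// ltr_wpDl.
  apply: filterS (@nbhs0_lt _ 'rV[R]_n _ d0) => h; rewrite lt_min => /andP[he].
  rewrite ltr_pdivlMr ?ltr_wpDl// => /ltW hK.
  have -> : (f \o shift x - (cst (f x) + df)) h = f (x + h) - f x - df h.
    by rewrite !fctE/= opprD addrA (addrC h).
  rewrite (le_trans (fK _ he))// expr2 mulrA ler_wpM2r//.
  by rewrite (le_trans _ hK)// mulrC ler_wpM2l// lerDl.
have dfE := diff_unique (@linear_form_continuous _ _ _) fdf.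
split; last by move=> v; rewrite dfE.
by apply/diff_locallyP; rewrite dfE; split => //; exact: linear_form_continuous.
Qed.

Lemma real_analytic_continuous f : real_analytic f -> continuous f.
Proof.
move=> af x; apply: differentiable_continuous.
by have [] := real_analytic_diff x af.
Qed.

Lemma is_derive_analytic_comp f (g : R -> 'rV[R]_n) (t : R) v : real_analytic f ->
  is_derive t 1 g v ->
  is_derive t 1 (f \o g) (\sum_i v ord0 i * partial i f (g t)).
Proof.
move=> af dg; have [df dfE] := real_analytic_diff (g t) af.
have dgt : differentiable g t by apply/derivable1_diffP; case: dg.
have dfg := differentiable_comp dgt df.
apply: DeriveDef; first exact: diff_derivable.
rewrite deriveE// diff_comp//= dfE -deriveE//.
by case: dg => _ ->.
Qed.

Lemma real_analytic_lipschitz f (K : set 'rV[R]_n) (D : R) : real_analytic f ->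
  (forall x y (t : R), K x -> K y -> 0 <= t <= 1 -> K (x + t *: (y - x))) ->
  (forall i x, K x -> `|partial i f x| <= D) ->
  forall x y, K x -> K y -> `|f y - f x| <= n%:R * D * `|y - x|.
Proof.
move=> af Kc KD x y Kx Ky; pose g (t : R) := x + t *: (y - x).
have dg (t : R) : is_derive t 1 g (y - x).
  have H : h^-1 *: ((g \o shift t) (h *: 1) - g t) @[h --> (0 : R)^'] --> y - x.
    apply: cvg_near_cst; apply: filterS (@nbhs_dnbhs_neq R 0) => h h0.
    rewrite /g/= opprD addrACA subrr add0r -scalerBl.
    by rewrite addrK scalerA [h *: _]mulr1 mulVf// scale1r.
  by apply: DeriveDef; [apply/cvg_ex; exists (y - x)|exact/cvg_lim].
have dfg t := is_derive_analytic_comp af (dg t).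
have cfg : {within `[0, 1], continuous (f \o g : R -> R)}.
  by apply: derivable_within_continuous => t _; case: (dfg t).
have [c c01] := @MVT_segment R (f \o g) _ 0 1 ler01 (fun t _ => dfg t) cfg.
rewrite /= /g scale1r scale0r addr0 subrKC subr0 mulr1 => ->.
rewrite (le_trans (ler_norm_sum _ _ _))// (le_trans (@ler_sum _ _ _ _ _ (fun=> D *
  `|y - x|) _))//.
  move=> i _; rewrite normrM mulrC ler_pM// ?ler_coord_norm//.
  by apply: KD; apply: Kc => //; move: c01; rewrite in_itv.
by rewrite sumr_const card_ord -[leLHS]mulr_natl mulrA.
Qed.

End analytic_differentiable.

(** * Word derivatives and majorants *)

Section word_derivatives.
Context {R : realType} {n : nat}.
Implicit Types (f g F : Comega R n) (x : 'rV[R]_n) (w : seq 'I_n).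

Lemma Comega_analytic f : real_analytic f.
Proof. by apply/analytic_predP; case: f. Qed.

Definition partialw (i : 'I_n) f : Comega R n :=
  MkComega (introT (analytic_predP _) (real_analytic_partial i (Comega_analytic f))).

(** Words instead of multi-indices let the Leibniz rule act one letter at a time, without binomial
    coefficients; [multi_partial_word] translates back. *)
Definition word_partial w f : Comega R n :=
  foldl (fun g i => partialw i g) f w.

Lemma partialwC i j f : partialw i (partialw j f) = partialw j (partialw i f).
Proof. by apply/val_inj/partialC/Comega_analytic. Qed.

Lemma word_partial_catCA i w1 w2 f :
  word_partial (w1 ++ i :: w2) f = word_partial (i :: w1 ++ w2) f.
Proof.
elim: w1 f => //= j w1 IH f; rewrite /word_partial/= -/(word_partial _ _) IH.
by rewrite /word_partial/= partialwC.
Qed.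

Lemma word_partial_perm w1 w2 f : perm_eq w1 w2 ->
  word_partial w1 f = word_partial w2 f.
Proof.
elim: w1 w2 f => [|i w1 IH] w2 f.
  by move=> /perm_size/esym/size0nil ->.
move=> pw; have : i \in w2 by rewrite -(perm_mem pw) mem_head.
move=> /splitPr iw2; case: iw2 pw => u v pw.
rewrite word_partial_catCA; apply: IH.
by rewrite -(perm_cons i) (perm_trans pw)// perm_catC/= perm_cons perm_catC.
Qed.

(** [multi_partial] differentiates along the word [wd], in which equal letters are grouped. It is a
    permutation of [w], and partial derivatives commute. *)
Lemma multi_partial_word w f :
  multi_partial (fun i => count_mem i w) f = word_partial w f.
Proof.
pose wd (s : seq 'I_n) :=
  foldr (fun i v => v ++ nseq (count_mem i w) i) [::] s.
have mwd s : foldr (fun (i : 'I_n) (g : 'rV[R]_n -> R^o) =>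
      iter (count_mem i w) (partial i) g) f s
    = word_partial (wd s) f.
  elim: s => //= i s ->; rewrite [in RHS]/word_partial foldl_cat.
  rewrite -/(word_partial _ f) -/(word_partial _ _).
  elim: (count_mem i w) (word_partial _ _) => // m IH g.
  by rewrite iterSr -(IH (partialw i g)).
rewrite /multi_partial mwd; congr (Comega_fun _); apply: word_partial_perm.
have cwd s j : count_mem j (wd s) = (\sum_(i <- s) (i == j) * count_mem i w)%N.
  elim: s => [|i s IH]/=; first by rewrite big_nil.
  by rewrite count_cat big_cons IH count_nseq addnC.
apply/allP => j _ /=; rewrite cwd big_enum/= (bigD1 j)//= eqxx mul1n.
by rewrite big1 ?addn0// => i /negbTE ->.
Qed.

Lemma sum_count_mem w : (\sum_i count_mem i w = size w)%N.
Proof.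
elim: w => [|j w IH]/=; first by rewrite big1.
rewrite big_split/= IH (bigD1 j)//= eqxx big1 ?addn0 ?add1n// => i.
by rewrite eq_sym => /negbTE ->.
Qed.

(** Products stay in an uncollected list: each differentiation doubles it, and repeated pairs play
    the role of binomial coefficients. *)
Definition product_sum (l : seq (Comega R n * Comega R n)) : 'rV[R]_n -> R^o :=
  fun x => \sum_(p <- l) p.1 x * p.2 x.

Definition leibniz_step i (l : seq (Comega R n * Comega R n)) :=
  flatten [seq [:: (partialw i p.1, p.2); (p.1, partialw i p.2)] | p <- l].

Definition leibniz w l := foldl (fun l i => leibniz_step i l) l w.

Lemma leibniz_cat w l1 l2 : leibniz w (l1 ++ l2) = leibniz w l1 ++ leibniz w l2.
Proof.
elim: w l1 l2 => //= i w IH l1 l2.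
by rewrite /leibniz_step map_cat flatten_cat IH.
Qed.

Lemma partial_product_sum i l : partial i (product_sum l)
  = product_sum (leibniz_step i l).
Proof.
apply/funext => x; suff [] : is_derive x (delta_mx ord0 i) (product_sum l)
  (product_sum (leibniz_step i l) x) by [].
elim: l => [|p l IH].
  have -> : product_sum [::] = cst 0.
    by apply/funext => y; rewrite /product_sum big_nil.
  by rewrite /cst; exact: is_derive_cst.
have -> : product_sum (p :: l) = (p.1 : _ -> R^o) * (p.2 : _ -> _) + product_sum l.
  by apply/funext => y; rewrite /product_sum big_cons.
have dp (f : Comega R n) : is_derive x (delta_mx ord0 i) f (partialw i f x).
  by apply: DeriveDef => //; exact: real_analytic_derivable (Comega_analytic f).
rewrite [X in is_derive _ _ _ X](_ : _ =
  (p.1 x *: partialw i p.2 x + p.2 x *: partialw i p.1 x) +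
  product_sum (leibniz_step i l) x).
  by apply: is_deriveD; exact: is_deriveM.
rewrite /product_sum /leibniz_step/= !big_cons/= addrA; congr (_ + _).
by rewrite /GRing.scale/= addrC; congr (_ + _); rewrite mulrC.
Qed.

Lemma word_partial_product_sum w F l : F = product_sum l :> (_ -> _) ->
  word_partial w F = product_sum (leibniz w l) :> (_ -> _).
Proof.
elim: w F l => //= i w IH F l Fl; apply: (IH (partialw i F)).
by rewrite /= Fl partial_product_sum.
Qed.

(** The right-hand side is the derivative of order [size w] at [s = 0] of the majorant
    [C / (1 - M s) ^ (a + 1)]. *)
Definition jet_bound (M : R) x a (C : R) f := forall w,
  `|word_partial w f x| <= C * M ^+ size w * ((a + size w)`!%:R / a`!%:R).

Lemma jet_bound_partial M x a C f i : jet_bound M x a C f ->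
  jet_bound M x a.+1 (C * M * a.+1%:R) (partialw i f).
Proof.
move=> bf w; apply: le_trans (bf (i :: w)) _; rewrite /= addnS addSn.
rewrite (factS a) natrM [leRHS](_ : _ = C * M ^+ (size w).+1 * ((a + size
  w).+1`!%:R / a`!%:R))//.
by rewrite exprS; field; rewrite pnatr_eq0 -lt0n fact_gt0/= nat1r pnatr_eq0.
Qed.

(** Exponents [a + 1] and [b + 1] of the majorants add up, which in this indexing gives
    [(a + b).+1]. Bounding the sum of absolute values makes the induction self-contained:
    differentiating the left or the right factor contributes [a + 1] or [b + 1], together the next
    factor [a + b + 2] of the factorial. *)
Lemma jet_bound_leibniz M x a b C D f g w : 0 <= C -> 0 <= D -> 0 <= M ->
  jet_bound M x a C f -> jet_bound M x b D g ->
  \sum_(p <- leibniz w [:: (f, g)]) `|p.1 x * p.2 x| <=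
    C * D * M ^+ size w * ((a + b).+1 + size w)`!%:R / (a + b).+1`!%:R.
Proof.
move=> C0 D0 M0; elim: w f g a b C D C0 D0 => [|i w IH] f g a b C D C0 D0 bf bg.
  rewrite big_seq1/= expr0 mulr1 addn0 mulfK ?pnatr_eq0 -?lt0n ?fact_gt0//.
  rewrite normrM ler_pM//.
    by have := bf [::]; rewrite /= expr0 mulr1 addn0 divff ?mulr1// pnatr_eq0 -lt0n
      fact_gt0.
  by have := bg [::]; rewrite /= expr0 mulr1 addn0 divff ?mulr1// pnatr_eq0 -lt0n
    fact_gt0.
rewrite (_ : leibniz (i :: w) [:: (f, g)] =
  leibniz w [:: (partialw i f, g)] ++ leibniz w [:: (f, partialw i g)]);
  last by rewrite -leibniz_cat.
rewrite big_cat/=.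
have C'0 : 0 <= C * M * a.+1%:R by rewrite !mulr_ge0.
have D'0 : 0 <= D * M * b.+1%:R by rewrite !mulr_ge0.
apply: le_trans (lerD (IH _ _ _ _ _ _ C'0 D0 (jet_bound_partial i bf) bg)
                      (IH _ _ _ _ _ _ C0 D'0 bf (jet_bound_partial i bg))) _.
rewrite !addSn !addnS -mulrDl.
rewrite (factS (a + b).+1) natrM le_eqVlt; apply/orP; left; apply/eqP.
have -> : (a + b).+2%:R = a.+1%:R + b.+1%:R :> R by rewrite -natrD addSn addnS.
rewrite exprS; field.
by rewrite pnatr_eq0 -lt0n fact_gt0/= gt_eqF.
Qed.

Lemma partial_coordinate (i j : 'I_n) (y : 'rV[R]_n) :
  partial i (coordinate R j : 'rV[R]_n -> R^o) y = (j == i)%:R.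
Proof.
suff [] : is_derive y (delta_mx ord0 i) (coordinate R j : 'rV[R]_n -> R^o)
  (j == i)%:R by [].
apply: (@is_derive_quadratic _ _ _ _ _ _ 0 1) => // t _.
by rewrite /= !mxE eqxx/= [X in `|X|](_ : _ = 0) ?normr0 ?mul0r//; ring.
Qed.

Lemma derivation_coordinate (V : 'rV[R]_n -> 'rV[R]_n) (A : LComega R n) j y :
  is_derivation_of V A -> A (coordinate R j) y = V y ord0 j.
Proof.
move=> VA; rewrite VA /lie_derivative (bigD1 j)//= partial_coordinate eqxx mulr1.
by rewrite big1 ?addr0// => i; rewrite partial_coordinate eq_sym => /negbTE ->;
  rewrite mulr0.
Qed.

(** Each of the [n] terms is a component of [V], with exponent index 0, times a partial derivative
    of [F], with index [a.+1]. The derivative yields [M * a.+1] and the product raises the index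
    once more. *)
Lemma jet_bound_derivation M x a C D (V : 'rV[R]_n -> 'rV[R]_n) (A : LComega R n) F :
  0 <= C -> 0 <= D -> 0 <= M -> is_derivation_of V A ->
  (forall j, jet_bound M x 0 C (A (coordinate R j))) -> jet_bound M x a D F ->
  jet_bound M x a.+2 (n%:R * C * D * M * a.+1%:R) (A F).
Proof.
move=> C0 D0 M0 VA bA bF w.
pose l := [seq (A (coordinate R j), partialw j F) | j <- enum 'I_n].
have AF : A F = product_sum l :> (_ -> _).
  apply/funext => y; rewrite VA /lie_derivative /product_sum big_map big_enum/=.
  by apply: eq_bigr => j _; rewrite (derivation_coordinate j y VA).
rewrite (word_partial_product_sum w AF).
have lE : leibniz w l = flatten [seq leibniz w [:: (A (coordinate R j), partialw j
  F)] | j <- enum 'I_n].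
  rewrite /l; elim: (enum 'I_n) => [|j s IH] /=; first by elim: w {AF bF}.
  by rewrite -IH -leibniz_cat.
rewrite /product_sum lE big_flatten/= big_map big_enum/=.
rewrite (le_trans (ler_norm_sum _ _ _))//.
rewrite (le_trans (@ler_sum _ _ _ _ _ (fun=> C * (D * M * a.+1%:R) * M ^+ size w *
  (a.+2 + size w)`!%:R / a.+2`!%:R) _))//.
  move=> j _; rewrite (le_trans (ler_norm_sum _ _ _))//.
  have := @jet_bound_leibniz M x 0 a.+1 C (D * M * a.+1%:R) (A (coordinate R j))
    (partialw j F) w C0.
  by apply => //; [rewrite !mulr_ge0|exact: jet_bound_partial].
rewrite sumr_const card_ord -[leLHS]mulr_natl !mulrA.
by rewrite [X in _ <= X](_ : _ = n%:R * C * D * M * a.+1%:R * M ^+ size w * (a.+2 +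
  size w)`!%:R / a.+2`!%:R)//; ring.
Qed.

(** The recursion removes the operator applied first, as a flow iteration does: its integrand
    [E' u \o X u] replaces [f] by [X u f]. *)
Fixpoint iterated_bound (S : set (LComega R n)) (K : set 'rV[R]_n) k f (D : R) : Prop :=
  match k with
  | 0%N => forall x, K x -> `|f x| <= D
  | k'.+1 => forall A, S A -> iterated_bound S K k' (A f) D
  end.

(** The first operator turns the coordinate into a component of its field, with [a = 0]. Each later
    one raises [a] by two and, at [a = 2 j], multiplies the constant by [n M^2 (2 j + 1)], at most
    [Q (j + 1)] for [Q = 2 n M^2]. *)
Lemma iterated_boundP (B : set ('rV[R]_n -> 'rV[R]_n)) K (M : R) : 0 <= M ->
  (forall A j x, derivations B A -> K x -> jet_bound M x 0 M (A (coordinate R j))) ->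
  forall k i, iterated_bound (derivations B) K k.+1 (coordinate R i)
    (M * (2 * n%:R * M ^+ 2) ^+ k * k`!%:R).
Proof.
move=> M0 bA k i; pose Q := 2 * n%:R * M ^+ 2.
have Q0 : 0 <= Q by rewrite !mulr_ge0 ?exprn_ge0.
suff H m j F : (forall x, K x -> jet_bound M x j.*2 (M * Q ^+ j * j`!%:R) F) ->
    iterated_bound (derivations B) K m F (M * Q ^+ (j + m) * (j + m)`!%:R).
  move=> A BA; apply: (H k 0%N) => x Kx.
  by rewrite expr0 !mulr1; exact: bA.
elim: m j F => [|m IH] j F bF.
  move=> x Kx; have := bF x Kx [::].
  by rewrite /= expr0 mulr1 !addn0 divff ?mulr1// pnatr_eq0 -lt0n fact_gt0.
move=> A BA; rewrite -addSnnS; apply: IH => x Kx w.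
have [V BV VA] := BA.
have D0 : 0 <= M * Q ^+ j * j`!%:R by rewrite !mulr_ge0 ?exprn_ge0.
have := @jet_bound_derivation M x j.*2 M _ V A F M0 D0 M0 VA (fun j => bA A j x BA
  Kx) (bF x Kx) w.
rewrite doubleS => /le_trans; apply;
  rewrite ler_wpM2r ?divr_ge0// ler_wpM2r ?exprn_ge0//.
rewrite [leLHS](_ : _ = M * Q ^+ j * j`!%:R * (n%:R * M ^+ 2) * j.*2.+1%:R);
  last by ring.
rewrite factS natrM (exprS Q) [leRHS](_ : _ =  M * Q ^+ j * j`!%:R * (n%:R * M ^+
  2) * j.+1.*2%:R).
  by rewrite ler_wpM2l ?ler_nat ?doubleS// !mulr_ge0// ?exprn_ge0// !mulr_ge0
    ?exprn_ge0.
by rewrite -muln2 natrM /Q; ring.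
Qed.

End word_derivatives.

(** * Uniform bounds from the omega-topology *)

Section uniform_bound.
Context {R : realType}.

Lemma c0_decreasing_harmonic : c0_decreasing (@harmonic R).
Proof.
split=> [j|//|]; [exact: harmonic_gt0| |exact: cvg_harmonic].
by apply/decreasing_seqP => j; rewrite /harmonic/= ltf_pV2 ?posrE// ltr_nat.
Qed.

(* If v > ((N_k - 1)^2)^(k+1) at a record k of N, then a sequence of order 1/N
   cannot compensate v: this is what the sequence a below exploits. *)
Lemma geometric_of_c0 (S : set (nat * R)) :
  (forall a, c0_decreasing a -> exists C, forall k v, S (k, v) ->
     (\prod_(j < k.+1) a j) * v <= C) ->
  exists2 M : R, 0 < M & forall k v, S (k, v) -> v <= M ^+ k.+1.
Proof.
move=> Sa.
have [C0 HC0] := Sa _ c0_decreasing_harmonic.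
(* For each fixed [k] the harmonic weights already bound [v], so [N k] exists. The square leaves a
   factor of order [N] after weights of order [1/N] have been paid for. *)
have Nex k : exists N : nat, `[< forall v, S (k, v) -> v <= (N%:R ^+ 2) ^+ k.+1 >].
  pose p : R := \prod_(j < k.+1) @harmonic R j.
  have p0 : 0 < p by apply: prodr_gt0 => j _; exact: harmonic_gt0.
  exists (Num.bound `|C0 / p|).+1; apply/asboolP => v /HC0; rewrite -/p => pv.
  apply: (@le_trans _ _ (Num.bound `|C0 / p|).+1%:R).
    rewrite -(@ler_pM2l _ p)// (le_trans pv)// mulrC -ler_pdivrMr//.
    by rewrite (le_trans (ler_norm _))// ltW// (lt_trans (archi_boundP (normr_ge0
      _)))// ltr_nat.
  by rewrite -exprM ler_eXnr// ler1n.
pose N k := ex_minn (Nex k).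
have NP k v : S (k, v) -> v <= ((N k)%:R ^+ 2) ^+ k.+1.
  by rewrite /N; case: ex_minnP => m /asboolP H _; exact: H.
have Nmin k m : (m < N k)%N -> exists2 v, S (k, v) & (m%:R ^+ 2) ^+ k.+1 < v.
  rewrite /N; case: ex_minnP => m' _ H mm'; apply: contrapT => nv.
  have : `[< forall v, S (k, v) -> v <= (m%:R ^+ 2) ^+ k.+1 >].
    apply/asboolP => v Sv; rewrite leNgt; apply/negP => vm; apply: nv.
    by exists v.
  by move=> /H; rewrite leqNgt mm'.
have [[N0 HN0]|unb] := pselect (exists N0, forall k, (N k <= N0)%N).
  exists (N0%:R ^+ 2 + 1); first by rewrite ltr_wpDl ?sqr_ge0.
  move=> k v /NP/le_trans; apply; rewrite lerXn2r ?nnegrE ?addr_ge0 ?sqr_ge0//.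
  by rewrite (@le_trans _ _ (N0%:R ^+ 2)) ?lerDl// lerXn2r ?nnegrE// ler_nat.
have {}unb N0 : exists k, (N0 <= N k)%N.
  apply: contrapT => H; apply: unb; exists N0 => k; rewrite leqNgt.
  by apply/negP => /ltnW HN; apply: H; exists k.
pose b j := (\max_(k < j.+1) N k)%N.
have bN j k : (k <= j)%N -> (N k <= b j)%N.
  by move=> kj; exact: (@leq_bigmax _ (fun k : 'I_j.+1 => N k) (Ordinal (kj : (k <
    j.+1)%N))).
have bmono j k : (j <= k)%N -> (b j <= b k)%N.
  move=> jk; apply/bigmax_leqP => i _; apply: bN.
  by rewrite (leq_trans _ jk)// -ltnS.
(* The first summand follows the running maximum of [N] and may be constant over long stretches; the
   harmonic summand makes [a] strictly decreasing. *)
pose a j : R := (b j).+1%:R^-1 + harmonic j.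
have aP : c0_decreasing a.
  split.
  - by move=> j; rewrite addr_gt0 ?invr_gt0 ?harmonic_gt0.
  - apply/decreasing_seqP => j; apply: ler_ltD.
      by rewrite lef_pV2 ?posrE// ler_nat ltnS bmono.
    by rewrite /harmonic/= ltf_pV2 ?posrE// ltr_nat.
  - rewrite -[X in _ --> X](addr0 0); apply: cvgD; last exact: cvg_harmonic.
    apply/cvgrPdist_lt => e e0; have [k Nk] := unb (Num.bound e^-1).
    near=> j; rewrite sub0r normrN gtr0_norm ?invr_gt0//.
    rewrite invf_plt ?posrE// (lt_le_trans (archi_boundP _)) ?invr_ge0 ?(ltW e0)//.
    rewrite ler_nat (leq_trans Nk)// ltnW// ltnS bN//.
    by near: j; exact: nbhs_infty_ge.
have [C HC] := Sa _ aP.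
(* The margin 4 is for the last estimate: with [m] the record value, [(m - 1)^2 / (m + 1) >= m - 3],
   which exceeds [C]. *)
have [k Nk] := unb (Num.bound `|C|).+4.
have [|[/= k' k'k] bk] := @bigop.eq_bigmax 'I_k.+1 (fun k => N k);
  first by rewrite card_ord.
have bk' : b k' = N k'.
  apply/eqP; rewrite eqn_leq bN// andbT -bk.
  exact: bmono.
have Nk' : ((Num.bound `|C|).+4 <= N k')%N.
  by rewrite (leq_trans Nk)// -bk bN.
have [|v Sv] := @Nmin k' (N k').-1; first by rewrite prednK// (leq_trans _ Nk').
set m := N k' in bk' Nk' * => mv.
exfalso; have := HC _ _ Sv; apply/negP; rewrite -ltNge.
have m1 : m.-1%:R = m%:R - 1 :> R.
  by rewrite -[in RHS](@prednK m) ?(leq_trans _ Nk')// -natr1 addrK.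
have mC : `|C| + 4 <= m%:R.
  rewrite (@le_trans _ _ (Num.bound `|C|).+4%:R) ?ler_nat//.
  by rewrite -(addn4 (Num.bound _)) natrD lerD2r ltW// archi_boundP.
have C0' := normr_ge0 C.
apply: (@lt_le_trans _ _ (m.+1%:R^-1 ^+ k'.+1 * (m.-1%:R ^+ 2) ^+ k'.+1)); last first.
  rewrite ler_pM ?exprn_ge0 ?invr_ge0 ?sqr_ge0//; last exact: ltW.
  rewrite -[X in _ ^+ X]card_ord -prodr_const; apply: ler_prod => j _.
  rewrite invr_ge0 ler0n /=; apply: (@le_trans _ _ (b j).+1%:R^-1).
    by rewrite lef_pV2 ?posrE// ler_nat ltnS -bk' bmono// -ltnS.
  by rewrite lerDl ltW// harmonic_gt0.
rewrite -exprMn; apply: (@lt_le_trans _ _ (m%:R - 3)).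
  by rewrite (le_lt_trans (ler_norm C))//; lra.
apply: (@le_trans _ _ (m.+1%:R^-1 * m.-1%:R ^+ 2)).
  rewrite mulrC ler_pdivlMr// m1 -natr1; nra.
rewrite ler_eXnr// mulrC ler_pdivlMr// m1 -natr1; nra.
Unshelve. all: by end_near. Qed.

(** All fields, components and points of [K] are pooled into one set [S] of normalised derivatives,
    so that the rate [M] is common to them. The seminorms at the finitely many coordinate functions
    suffice, as they see the components of the fields. *)
Lemma derivations_jet_bound n (B : set ('rV[R]_n -> 'rV[R]_n)) (K : set 'rV[R]_n) :
  omega_bounded (derivations B) -> compact K ->
  exists2 M : R, 0 < M & forall A j x, derivations B A -> K x ->
    jet_bound M x 0 M (A (coordinate R j)).
Proof.
move=> bB cK.
pose S : set (nat * R) := [set kv | exists A j x w, [/\ derivations B A, K x,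
   kv.1 = size w & kv.2 = `|word_partial w (A (coordinate R j)) x| / (size w)`!%:R]].
have [|M M0 HM] := @geometric_of_c0 S.
  move=> a a0.
  have /choice[C HC] j : exists C : R, forall A : LComega R n, derivations B A ->
    (rho K a (coordinate R j) A <= C%:E)%E by exact: bB.
  exists (\sum_j `|C j|) => k v [A [j [x [w [BA Kx /= -> ->]]]]].
  apply: (@le_trans _ _ (C j)); last first.
    by rewrite (le_trans (ler_norm _))// (bigD1 j)//= lerDl sumr_ge0.
  rewrite -lee_fin; apply: le_trans (HC j A BA); rewrite /rho le_max; apply/orP; right.
  apply: ereal_sup_ubound => /=; exists x, (fun i => count_mem i w); split => //.
  by rewrite multi_partial_word sum_count_mem mulrA mulrAC.
exists M => // A j x BA Kx w.
rewrite add0n fact0 divr1 -exprS -ler_pdivrMr ?ltr0n ?fact_gt0//.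
by apply: HM; exists A, j, x, w.
Qed.

End uniform_bound.

(** * Absolutely continuous functions *)

Section absolutely_continuous_bound.
Context {R : realType}.
Notation mu := (@lebesgue_measure R).

Definition ac_real (T : R) (phi : R -> R) : Prop :=
  forall e : R, 0 < e -> exists2 d : R, 0 < d &
    forall (m : nat) (u v : 'I_m -> R),
      (forall j, [/\ 0 <= u j, u j <= v j & v j <= T]) ->
      trivIset setT (fun j => `]u j, v j[%classic) ->
      \sum_j (v j - u j) < d -> \sum_j `|phi (v j) - phi (u j)| < e.

Lemma negligible_open_cover (N : set R) (d : R) : mu.-negligible N -> 0 < d ->
  exists U, [/\ open U, N `<=` U & (mu U < d%:E)%E].
Proof.
move=> [A [mA A0 NA]] d0.
have [|U [oU AU Ud]] := @lebesgue_regularity_outer R A d mA _ d0.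
  by rewrite [X in (X < _)%E]A0 ltry.
exists U; split => //; first exact: subset_trans AU.
have UA0 : mu (U `&` A) = 0%E.
  apply/eqP; rewrite -measure_le0 -[X in (_ <= X)%E]A0; apply: le_measure;
    rewrite ?inE//.
  by apply: measurableI => //; exact: open_measurable.
have -> : mu U = (mu (U `\` A) + mu (U `&` A))%E.
  by apply: measureDI => //; exact: open_measurable.
by rewrite UA0 adde0.
Qed.

(** The condition [u <= t <= v] makes the lengths [t - u] and [v - t] add up to [v - u]. *)
Lemma is_derive_straddle (phi : R -> R) (t l D e : R) : 0 < e ->
  is_derive t 1 phi l -> `|l| <= D ->
  exists2 d : R, 0 < d & forall u v, t - d < u -> u <= t -> t <= v -> v < t + d ->
    `|phi v - phi u| <= (D + e) * (v - u).
Proof.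
move=> e0 [dphi phil] lD.
have cl : h^-1 *: ((phi \o shift t) (h *: 1) - phi t) @[h --> (0 : R)^'] --> l.
  by rewrite -phil; exact: dphi.
have /cvgrPdist_le/(_ _ e0) := cl.
move=> [d/= d0 Hd]; exists d => //.
have H x : `|x - t| < d -> `|phi x - phi t| <= (D + e) * `|x - t|.
  move=> xd; have [->|xt] := eqVneq x t; first by rewrite !subrr normr0 mulr0.
  have xt0 : x - t != 0 by rewrite subr_eq0.
  have := Hd (x - t); rewrite /ball/= sub0r normrN => /(_ xd xt0).
  rewrite [(x - t) *: 1]mulr1 subrK /GRing.scale/= => H.
  have -> : phi x - phi t = (x - t) * ((x - t)^-1 * (phi x - phi t)).
    by rewrite mulrA divff// mul1r.
  rewrite normrM mulrC ler_wpM2r//.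
  rewrite -[X in `|X|](subrK l) addrC (le_trans (ler_normD _ _))// lerD//.
  by rewrite distrC.
move=> u v tu ut tv vt.
have -> : phi v - phi u = (phi v - phi t) - (phi u - phi t) by ring.
rewrite (le_trans (ler_normB _ _))//.
have Hv : `|phi v - phi t| <= (D + e) * (v - t).
  by have := H v; rewrite (@ger0_norm _ (v - t)) ?subr_ge0//; apply; lra.
have Hu : `|phi u - phi t| <= (D + e) * (t - u).
  by have := H u; rewrite (distrC u) (@ger0_norm _ (t - u)) ?subr_ge0//; apply; lra.
by rewrite (le_trans (lerD Hv Hu))// -mulrDr addrA subrK.
Qed.

(* Continuous induction on s: the increment of phi over [0, s] is at most
   (D + eps) s plus the increments over finitely many disjoint intervals of
   total length at most the measure of U, where U is an open neighbourhood of
   the exceptional set. *)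
Lemma ac_derive_bound (T D : R) (phi : R -> R) : 0 <= D -> ac_real T phi ->
  {ae mu, forall t, 0 <= t <= T ->
    exists2 l, is_derive t 1 phi l & `|l| <= D} ->
  forall t, 0 <= t <= T -> `|phi t - phi 0| <= D * t.
Proof.
move=> D0 acphi [N [mN N0 HN]] b /andP[b0 bT].
have dphi t : 0 <= t <= T -> ~ N t -> exists2 l, is_derive t 1 phi l & `|l| <= D.
  by move=> tT Nt; apply: contrapT => H; apply: Nt; apply: HN => /= H';
    exact: H (H' tT).
(* The excess slope costs [e * b] and the exceptional intervals cost [e], together [e']. *)
apply/ler_addgt0Pr => e' e'0; pose e := e' / (b + 1).
have e0 : 0 < e by rewrite divr_gt0// ltr_wpDl.
have [d d0 Hd] := acphi e e0.
have [|U [oU NU Ud]] := @negligible_open_cover N d _ d0; first by exists N; split.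
(* The intervals are ordered from left to right, so a new one can be appended at the end. Half-open
   [[0, s[] makes the measures of consecutive pieces add up. *)
pose Q (s : R) := exists m (u v : nat -> R), [/\
  forall j, (j < m)%N -> [/\ 0 <= u j, u j <= v j & v j <= s],
  forall i j, (i < j)%N -> (j < m)%N -> v i <= u j,
  ((\sum_(j < m) (v j - u j))%:E <= mu (U `&` `[0%R, s[))%E &
  `|phi s - phi 0| <= (D + e) * s + \sum_(j < m) `|phi (v j) - phi (u j)|].
have mUi (i : interval R) : measurable (U `&` [set` i]).
  by apply: measurableI => //; exact: open_measurable.
have Q0 : Q 0.
  exists 0%N, (fun=> 0), (fun=> 0); split => //.
    by rewrite big_ord0 measure_ge0.
  by rewrite big_ord0 mulr0 addr0 subrr normr0.
have Qbad s s' : 0 <= s -> s <= s' -> `[s, s'[ `<=` U -> Q s -> Q s'.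
  move=> s0 ss' sU [m [u [v [uv ord len bnd]]]].
  exists m.+1, (fun j => if (j < m)%N then u j else s),
    (fun j => if (j < m)%N then v j else s'); split.
  - move=> j; rewrite ltnS leq_eqVlt => /predU1P[->|jm]; first by rewrite ltnn.
    by rewrite jm; have [? ? ?] := uv j jm; split => //; exact: le_trans ss'.
  - move=> i j ij; rewrite ltnS leq_eqVlt => /predU1P[jm|jm].
      by rewrite jm ltnn -jm ij; rewrite jm in ij; have [] := uv i ij.
    by rewrite (ltn_trans ij jm) jm; exact: ord.
  - rewrite big_ord_recr/= ltnn.
    under eq_bigr do rewrite ltn_ord.
    rewrite EFinD.
    have -> : U `&` `[0%R, s'[ = (U `&` `[0%R, s[) `|` `[s, s'[.
      apply/seteqP; split => [x [Ux]|x [[Ux]|xs]]/=.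
      + rewrite in_itv/= => /andP[x0 xs']; have [xs|xs] := ltP x s.
          by left; split => //=; rewrite in_itv/= x0.
        by right; rewrite in_itv/= xs.
      + rewrite /= in_itv/= => /andP[x0 xs]; split => //=.
        by rewrite in_itv/= x0 (lt_le_trans xs).
      + split; first exact: sU.
        by move: xs; rewrite /= !in_itv/= => /andP[sx ->]; rewrite (le_trans s0).
    have dj : U `&` `[0%R, s[ `&` `[s, s'[ = set0.
      apply/seteqP; split => // x [[_]]/=; rewrite !in_itv/= => /andP[_ xs] /andP[].
      by rewrite leNgt xs.
    have -> : mu ((U `&` `[0%R, s[) `|` `[s, s'[) =
        (mu (U `&` `[0%R, s[) + mu `[s, s'[)%E.
      by apply: measureU => //; exact: mUi.
    rewrite leeD// lebesgue_measure_itv/= lte_fin.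
    by case: ltP => // s's; rewrite lee_fin subr_le0.
  - rewrite big_ord_recr/= ltnn.
    under eq_bigr do rewrite ltn_ord.
    have -> : phi s' - phi 0 = (phi s' - phi s) + (phi s - phi 0) by ring.
    rewrite (le_trans (ler_normD _ _))// addrA [leRHS]addrC lerD2l (le_trans bnd)//.
    by rewrite lerD2r ler_wpM2l// addr_ge0// ltW.
have Qgood s s' : s <= s' -> `|phi s' - phi s| <= (D + e) * (s' - s) -> Q s -> Q s'.
  move=> ss' ps [m [u [v [uv ord len bnd]]]]; exists m, u, v; split => //.
  - by move=> j jm; have [? ? ?] := uv j jm; split => //; exact: le_trans ss'.
  - apply: le_trans len _; apply: le_measure; rewrite ?inE; [exact: mUi|exact: mUi|].
    apply: setIS => x/=; rewrite !in_itv/=.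
    by move=> /andP[-> /lt_le_trans]; apply.
  - have -> : phi s' - phi 0 = (phi s' - phi s) + (phi s - phi 0) by ring.
    rewrite (le_trans (ler_normD _ _))// (le_trans (lerD ps bnd))// addrA -mulrDr.
    by rewrite subrK.
have Qb : Q b.
  pose A := [set s | 0 <= s <= b /\ Q s].
  have A0 : A 0 by split => //; rewrite lexx.
  have Ab : ubound A b by move=> s [/andP[]].
  have supA : has_sup A by split; [exists 0|exists b].
  set c := sup A.
  have c0 : 0 <= c by apply: ub_le_sup => //; exists b.
  have cb : c <= b by apply: ge_sup => //; exists 0.
  (* [Q] can be carried across [c]: inside [U] if [c] is exceptional, by the straddle estimate
     otherwise. As [Q] holds within [eta] below the supremum [c], it would hold beyond [c] unless
     [c = b]. *)
  have [eta eta0 Heta] : exists2 eta, 0 < eta & forall s s', 0 <= s ->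
      c - eta < s -> s <= c -> c <= s' -> s' < c + eta -> Q s -> Q s'.
    have [Nc|Nc] := pselect (N c).
      have /nbhs_ballP[eta/= eta0 Hb] : nbhs c U by apply: open_nbhs_nbhs;
        split => //; exact: NU.
      exists eta => // s s' s0 cs sc cs' s'c; apply: Qbad => //;
        first exact: le_trans cs'.
      move=> x/=; rewrite in_itv/= => /andP[sx xs']; apply: Hb.
      by rewrite /ball/= ltr_norml; apply/andP; split; lra.
    have [|l dl lD] := dphi c _ Nc; first by rewrite c0 (le_trans cb).
    have [eta eta0 Hb] := is_derive_straddle e0 dl lD.
    exists eta => // s s' s0 cs sc cs' s'c; apply: Qgood; first exact: le_trans cs'.
    exact: Hb.
  have [s [/andP[s0 sb] Qs] cs] := sup_adherent eta0 supA.
  have sc : s <= c by apply: ub_le_sup; [exists b|split; rewrite ?s0].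
  pose s' := Num.min b (c + eta / 2).
  have cs' : c <= s' by rewrite le_min cb lerDl divr_ge0// ltW.
  have Qs' : Q s'.
    apply: (Heta s) => //; rewrite /s' gt_min; apply/orP; right; lra.
  have : s' <= c.
    apply: ub_le_sup; first by exists b.
    by split => //; rewrite (le_trans c0 cs') ge_min lexx.
  rewrite /s' ge_min => /orP[bc|]; last by move=> H; exfalso; lra.
  suff <- : s' = b by [].
  by rewrite /s'; apply/min_idPl; rewrite (le_trans bc)// lerDl divr_ge0// ltW.
have [m [u [v [uv ord len bnd]]]] := Qb.
rewrite (le_trans bnd)//.
have : \sum_(j < m) `|phi (v j) - phi (u j)| < e.
  apply: (Hd m (fun j => u j) (fun j => v j)).
  - by move=> j; have [? ? vb] := uv j (ltn_ord j); split => //; exact: le_trans bT.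
  - apply/trivIsetP => i j _ _; wlog ij : i j / (i < j)%N.
      move=> H ij; have [lij|lji|/val_inj] := ltngtP i j; last by move/eqP: ij.
        exact: H lij ij.
      by rewrite setIC; apply: H lji _; rewrite eq_sym.
    move=> _; apply/seteqP; split => // x []/=;
      rewrite !in_itv/= => /andP[_ xv] /andP[ux _].
    have := ord i j ij (ltn_ord j); rewrite leNgt (lt_trans ux)//.
  - rewrite -lte_fin (le_lt_trans len)// (le_lt_trans _ Ud)//.
    apply: le_measure; rewrite ?inE; [exact: mUi|exact: open_measurable|].
    exact: subIsetl.
move=> He; have -> : e' = e * b + e.
  by rewrite -[X in _ + X]mulr1 -mulrDr /e divfK// gt_eqF// ltr_wpDl.
by rewrite mulrDl -addrA lerD2l lerD2l ltW.
Qed.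

End absolutely_continuous_bound.

(** * Piecewise constant curves and primitives *)

Section regular_times.
Context {R : realType}.
Notation mu := (@lebesgue_measure R).

Definition regular_times (T : R) (s : seq R) : set R :=
  [set u | 0 < u < T /\ u \notin s].

Lemma near_notin (s : seq R) (u : R) : u \notin s ->
  \forall v \near u, v \notin s.
Proof.
elim: s => [_|a s IH]; first by apply: filterS filterT => v _; rewrite in_nil.
rewrite inE negb_or => /andP[ua us].
have va : \forall v \near u, v != a.
  have ua0 : 0 < `|u - a| by rewrite normr_gt0 subr_eq0.
  apply/nbhs_ballP; exists `|u - a| => //= v; rewrite /ball/=.
  by apply: contraPneq => ->; rewrite ltxx.
near=> v; rewrite inE negb_or; apply/andP; split; near: v => //.
exact: IH.
Unshelve. all: by end_near. Qed.

Lemma open_regular_times T s : open (regular_times T s).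
Proof.
rewrite openE => u [u0T us]; rewrite /interior; near=> v; split.
  by near: v; have := near_in_itvoo (a := 0) (b := T) (x := u);
    rewrite in_itv/= => /(_ u0T); apply: filterS => w; rewrite in_itv.
by near: v; exact: near_notin.
Unshelve. all: by end_near. Qed.

Lemma ae_regular_times T s :
  {ae mu, forall u, 0 <= u <= T -> regular_times T s u}.
Proof.
have cs : countable [set` [:: 0, T & s]].
  by apply: finite_set_countable; exact: finite_seq.
exists [set` [:: 0, T & s]]; split.
- exact: countable_measurable.
- exact: countable_lebesgue_measure0.
move=> u /= nu; apply: contrapT => /negP us; apply: nu => /andP[u0 uT].
move: us; rewrite !inE !negb_or => /and3P[uN0 uNT us]; split => //.
by rewrite !lt_neqAle eq_sym uN0 u0 uNT uT.
Qed.

Lemma ae_in_ball (P : set R) (u e : R) : 0 < e -> {ae mu, forall t, P t} ->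
  exists2 v, `|v - u| < e & P v.
Proof.
move=> e0 [N [mN N0 HN]]; apply: contrapT => nv.
have : (mu (ball u e) <= mu N)%E.
  apply: le_measure; rewrite ?inE//; first exact: measurable_ball.
  move=> v uv; apply: HN => /= Pv; apply: nv; exists v => //.
  by move: uv; rewrite /ball/= distrC.
rewrite [X in (_ <= X)%E -> _]N0 lebesgue_measure_ball ?(ltW e0)// lee_fin.
by rewrite leNgt mulrn_wgt0.
Qed.

Definition eq_closed {n} (S : set (LComega R n)) := forall A A' : LComega R n,
  A =1 A' -> S A -> S A'.

Lemma eq_closed_derivations n (B : set ('rV[R]_n -> 'rV[R]_n)) :
  eq_closed (derivations B).
Proof.
move=> A A' AA' [V BV VA]; exists V => // f x.
by rewrite -VA AA'.
Qed.

(** Near a regular time the curve is constant, and every ball contains a time at which it is in [S];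
    hence membership holds at every regular time. Constancy is only pointwise equality of operators,
    which is why [S] must be [eq_closed]. *)
Lemma PC_regular n T (S : set (LComega R n)) X : eq_closed S -> PC T S X ->
  exists s, forall u, regular_times T s u ->
    S (X u) /\ \forall v \near u, X v =1 X u.
Proof.
move=> Seq [[s Xs] aeS]; exists s => u Gu.
have cX : \forall v \near u, X v =1 X u.
  have /nbhs_ballP[e/= e0 He] : nbhs u (regular_times T s).
    by apply: open_nbhs_nbhs; split => //; exact: open_regular_times.
  apply/nbhs_ballP; exists e => //= v uv.
  have Gw w : Num.min u v <= w <= Num.max u v -> regular_times T s w.
    move=> /andP[w1 w2]; apply: He; move: uv; rewrite /ball/= !ltr_norml => /andP[? ?].
    move: w1 w2; rewrite ge_min le_max => /orP[?|?] /orP[?|?]; apply/andP; split; lra.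
  have Xmm : X (Num.min u v) =1 X (Num.max u v).
    apply: Xs.
    - by have [] := Gw (Num.min u v);
      rewrite ?lexx ?le_max ?ge_min ?lexx// => /andP[/ltW].
    - by rewrite le_max ge_min lexx.
    - by have [] := Gw (Num.max u v);
      rewrite ?lexx ?le_max ?ge_min ?lexx// => /andP[_ /ltW].
    - by move=> w ws; apply/negP => /Gw[_]; rewrite ws.
  by move=> f; have := Xmm f; case: (leP u v).
split => //.
have /nbhs_ballP[e/= e0 He] : nbhs u ([set v | X v =1 X u] `&` regular_times T s).
  apply: filterI => //.
  by apply: open_nbhs_nbhs; split => //; exact: open_regular_times.
have [v vu Sv] := ae_in_ball u e0 aeS.
have [Xvu [/andP[v0 vT] _]] : ([set v | X v =1 X u] `&` regular_times T s) v.
  by apply: He; rewrite /ball/= distrC.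
by apply: (Seq _ _ Xvu); apply: Sv; rewrite !ltW.
Qed.

Lemma continuous_regular n (X : R -> LComega R n) (f : Comega R n)
    (g : R -> 'rV[R]_n) (u : R) :
  (\forall v \near u, X v =1 X u) -> {for u, continuous g} ->
  {for u, continuous (fun u => X u f (g u) : R)}.
Proof.
move=> Xu gu.
have : (X u f \o g) v @[v --> u] --> (X u f (g u) : R).
  by apply: continuous_comp => //;
    exact: real_analytic_continuous (Comega_analytic _) _.
apply: cvg_trans; apply: near_eq_cvg; near=> v => /=.
by congr (Comega_fun _ _); apply/esym; near: v; apply: filterS Xu => v; exact.
Unshelve. all: by end_near. Qed.

End regular_times.

Section field_along_curve.
Context {R : realType} {n : nat}.
Variables (S : set (LComega R n)) (T : R) (s : seq R) (X : R -> LComega R n).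
Variables (g : R -> 'rV[R]_n) (K : set 'rV[R]_n).
Hypothesis regX : forall u, regular_times T s u ->
  S (X u) /\ \forall v \near u, X v =1 X u.
Hypothesis gK : forall t, 0 <= t <= T -> K (g t).
Hypothesis gc : forall u, 0 < u < T -> {for u, continuous g}.
Variables (f : Comega R n) (D : R).
Hypothesis D0 : 0 <= D.
Hypothesis boundD : forall A x, S A -> K x -> `|A f x| <= D.

(* Set to 0 at the break points, where X need not be a derivation. *)
Definition along_curve : R -> R :=
  (fun u => X u f (g u) : R) \_ (regular_times T s).

Lemma along_curveE u : regular_times T s u -> along_curve u = X u f (g u).
Proof. by move=> Gu; rewrite /along_curve patchE mem_set. Qed.

Lemma along_curve_le u : `|along_curve u| <= D.
Proof.
rewrite /along_curve patchE; case: ifPn => [/set_mem Gu|_]; last by rewrite normr0.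
apply: boundD; first by have [] := regX Gu.
by apply: gK; case: Gu => /andP[? ?] _; rewrite !ltW.
Qed.

Lemma along_curve_measurable : measurable_fun setT along_curve.
Proof.
have oG := @open_regular_times R T s.
apply/(measurable_restrictT _ _).1; first exact: open_measurable.
apply: open_continuous_measurable_fun => // u /set_mem Gu.
apply: continuous_regular; first by have [] := regX Gu.
by apply: gc; case: Gu.
Qed.

Lemma along_curve_continuous u : regular_times T s u ->
  {for u, continuous along_curve}.
Proof.
move=> Gu; have [_ Xu] := regX Gu; have [u0T _] := Gu.
have cu := continuous_regular (f := f) Xu (gc u0T).
have nG : nbhs u (regular_times T s).
  by apply: open_nbhs_nbhs; split => //; exact: open_regular_times.
rewrite /prop_for/continuous_at (along_curveE Gu); move: cu; apply: cvg_trans.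
by apply: near_eq_cvg; apply: filterS nG => v Gv; rewrite along_curveE.
Qed.

End field_along_curve.

Section primitive.
Context {R : realType}.
Notation mu := (@lebesgue_measure R).
Implicit Types (h : R -> R) (C t : R).

Definition primitive h t : R := \int[mu]_(u in `[0, t]) h u.

Lemma bounded_integrable h C (A : set R) : measurable A -> (mu A < +oo)%E ->
  measurable_fun setT h -> (forall u, `|h u| <= C) ->
  mu.-integrable A (EFin \o h).
Proof.
move=> mA Aoo mh hC; apply: measurable_bounded_integrable => //.
  exact: measurable_funTS.
exists C; split; first exact: num_real.
by move=> M CM u _ /=; rewrite (le_trans (hC u))// ltW.
Qed.

Lemma itv_integrable h C (a b : R) (p q : bool) : measurable_fun setT h ->
  (forall u, `|h u| <= C) ->
  mu.-integrable [set` Interval (BSide p a) (BSide q b)] (EFin \o h).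
Proof.
move=> mh hC; apply: (bounded_integrable (C := C)) => //.
rewrite lebesgue_measure_itv/=; case: ifPn => _; last by rewrite ltry.
by rewrite -EFinB ltry.
Qed.

Lemma primitive0 h : primitive h 0 = 0.
Proof. by rewrite /primitive set_itv1 Rintegral_set1. Qed.

Lemma norm_Rintegral_itv_le h C (a b : R) (p q : bool) : measurable_fun setT h ->
  (forall u, `|h u| <= C) -> a <= b ->
  `|\int[mu]_(u in [set` Interval (BSide p a) (BSide q b)]) h u| <= C * (b - a).
Proof.
move=> mh hC ab; have C0 : 0 <= C by rewrite (le_trans _ (hC 0)).
have ih := itv_integrable a b p q mh hC.
rewrite (le_trans (le_normr_Rintegral _ ih))//.
rewrite (le_trans (@le_Rintegral _ _ _ mu _ _ (fun=> C) _ _ _ _))//.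
- exact: integrable_norm.
- apply: (bounded_integrable (C := C)) => //; last by move=> _; rewrite ger0_norm.
  rewrite lebesgue_measure_itv/=; case: ifPn => _; last by rewrite ltry.
  by rewrite -EFinB ltry.
rewrite Rintegral_cst//= ler_wpM2l// lebesgue_measure_itv/=.
by case: ifPn => _ //=; rewrite subr_ge0.
Qed.

Lemma primitive_lipschitz h C s t : measurable_fun setT h ->
  (forall u, `|h u| <= C) -> 0 <= s -> s <= t ->
  `|primitive h t - primitive h s| <= C * (t - s).
Proof.
move=> mh hC s0 st; rewrite /primitive Rintegral_itvB ?bnd_simp//.
  exact: norm_Rintegral_itv_le.
exact: itv_integrable hC.
Qed.

Lemma primitive_diff h h' C C' D t : measurable_fun setT h ->
  measurable_fun setT h' -> (forall u, `|h u| <= C) -> (forall u, `|h' u| <= C') ->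
  (forall u, `|h u - h' u| <= D) -> 0 <= t ->
  `|primitive h t - primitive h' t| <= D * t.
Proof.
move=> mh mh' hC hC' hD t0; rewrite /primitive -RintegralB//.
- rewrite -[X in _ * X]subr0; apply: norm_Rintegral_itv_le => //.
  exact: measurable_funB.
- exact: itv_integrable hC.
- exact: itv_integrable hC'.
Qed.

Lemma is_derive_primitive h C t : measurable_fun setT h ->
  (forall u, `|h u| <= C) -> 0 < t -> {for t, continuous h} ->
  is_derive t 1 (primitive h) (h t).
Proof.
move=> mh hC t0 ch.
have ih := itv_integrable 0 (t + 1) true false mh hC.
have [|d1 d2] := @continuous_FTC1_closed R h 0 t (t + 1) _ ih t0 ch.
  by rewrite ltrDl.
by apply: DeriveDef => //; rewrite -derive1E.
Qed.

End primitive.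

(** * Closed balls and uniform bounds on them *)

Section closed_balls.
Context {R : realType} {n : nat}.
Implicit Types (x y : 'rV[R]_n) (f : Comega R n).

Definition cball x (r : R) : set 'rV[R]_n := [set y | `|y - x| <= r].

Lemma compact_cball x r : compact (cball x r).
Proof.
apply: bounded_closed_compact.
  exists (r + `|x|); split; first exact: num_real.
  move=> M rM y /= yx; rewrite (le_trans _ (ltW rM))//.
  by rewrite -[y](subrK x) (le_trans (ler_normD _ _))// lerD2r.
rewrite (_ : cball x r = (fun y => `|y - x|) @^-1` [set z | z <= r])//.
apply: closed_comp; last exact: closed_le.
move=> y _; apply: (@continuous_comp _ _ _ (fun y => y - x) (@Num.norm _ _)).
  by apply: continuousB; [exact: cvg_id|exact: cst_continuous].
exact: norm_continuous.
Qed.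

Lemma cball_convex z r x y (t : R) : cball z r x -> cball z r y -> 0 <= t <= 1 ->
  cball z r (x + t *: (y - x)).
Proof.
rewrite /cball/= => xz yz /andP[t0 t1].
have -> : x + t *: (y - x) - z = (1 - t) *: (x - z) + t *: (y - z).
  by rewrite scalerBl scale1r !scalerBr; apply/rowP => i; rewrite !mxE; ring.
rewrite (le_trans (ler_normD _ _))// !normrZ (ger0_norm t0) ger0_norm ?subr_ge0//.
have : (1 - t) * `|x - z| <= (1 - t) * r by rewrite ler_wpM2l ?subr_ge0.
have : t * `|y - z| <= t * r by rewrite ler_wpM2l.
lra.
Qed.

Lemma lipschitz_on_cball f z (r : R) : exists2 L : R, 0 <= L &
  forall x y, cball z r x -> cball z r y -> `|f y - f x| <= L * `|y - x|.
Proof.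
have bd j : exists D, forall x, cball z r x -> `|partial j f x| <= D.
  have := @compact_bounded R R^o [set partialw j f x | x in cball z r].
  have cp : compact [set partialw j f x | x in cball z r].
    apply: continuous_compact; last exact: compact_cball.
    apply: continuous_subspaceT => x.
    exact: real_analytic_continuous (Comega_analytic _) _.
  move=> /(_ cp)[M [_ HM]]; exists (M + 1) => x Kx.
  by apply: (HM (M + 1)); [rewrite ltrDl|exists x].
have [D HD] := choice bd.
exists (n%:R * \sum_j `|D j|); first by rewrite mulr_ge0 ?sumr_ge0.
move=> x y Kx Ky.
apply: (@real_analytic_lipschitz _ _ f (cball z r)) => //.
- exact: Comega_analytic.
- by move=> *; exact: cball_convex.
- move=> j u Ku; rewrite (le_trans (HD j u Ku))// (le_trans (ler_norm _))//.
  by rewrite (bigD1 j)//= lerDl sumr_ge0.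
Qed.

(** The multi-index 0 enters the supremum with weight [harmonic 0 = 1]. *)
Lemma rho_ge (K : set 'rV[R]_n) f (A : Comega R n -> Comega R n) x : K x ->
  (`|A f x|%:E <= rho K harmonic f A)%E.
Proof.
move=> Kx; rewrite /rho le_max; apply/orP; right.
apply: ereal_sup_ubound => /=; exists x, (fun i => count_mem i [::]); split => //.
rewrite multi_partial_word sum_count_mem/= big_ord1 /harmonic/= fact0 invr1.
by rewrite !mul1r.
Qed.

Lemma omega_bounded_cball (S : set (LComega R n)) f z (r : R) : omega_bounded S ->
  exists2 C : R, 0 <= C & forall A x, S A -> cball z r x -> `|A f x| <= C.
Proof.
move=> bS; have [C HC] := bS _ _ f (@compact_cball z r) c0_decreasing_harmonic.
exists `|C| => // A x SA Kx; rewrite (le_trans _ (ler_norm C))// -lee_fin.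
by apply: le_trans (HC A SA); exact: rho_ge.
Qed.

End closed_balls.

(** * Stability of absolute continuity *)

Section absolutely_continuous_theory.
Context {R : realType} {n : nat}.
Notation mu := (@lebesgue_measure R).

Lemma ac_real_le (T T' : R) phi : T' <= T -> ac_real T phi -> ac_real T' phi.
Proof.
move=> TT' ac e e0; have [d d0 Hd] := ac e e0; exists d => // m u v uv.
by apply: Hd => j; have [? ? ?] := uv j; split => //; exact: le_trans TT'.
Qed.

Lemma ac_realB (T : R) phi psi : ac_real T phi -> ac_real T psi ->
  ac_real T (phi - psi).
Proof.
move=> ac1 ac2 e e0; have e20 : 0 < e / 2 by rewrite divr_gt0.
have [d1 d10 H1] := ac1 _ e20; have [d2 d20 H2] := ac2 _ e20.
exists (Num.min d1 d2); first by rewrite lt_min d10.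
move=> m u v uv tr; rewrite lt_min => /andP[s1 s2].
have := ltrD (H1 m u v uv tr s1) (H2 m u v uv tr s2); rewrite -splitr.
apply: le_lt_trans; rewrite -big_split/=; apply: ler_sum => j _.
rewrite (_ : _ - _ = (phi (v j) - phi (u j)) - (psi (v j) - psi (u j))).
  exact: ler_normB.
by rewrite !fctE; ring.
Qed.

Lemma ac_real_lipschitz (T L : R) phi :
  (forall s t, 0 <= s -> s <= t -> t <= T -> `|phi t - phi s| <= L * (t - s)) ->
  ac_real T phi.
Proof.
move=> lip e e0; exists (e / (`|L| + 1)); first by rewrite divr_gt0// ltr_wpDl.
move=> m u v uv _; rewrite ltr_pdivlMr ?ltr_wpDl//; apply: le_lt_trans.
rewrite mulr_suml; apply: ler_sum => j _; have [u0 uvj vT] := uv j.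
rewrite (le_trans (lip _ _ u0 uvj vT))// mulrC ler_wpM2l ?subr_ge0//.
by rewrite (le_trans (ler_norm _))// lerDl.
Qed.

Lemma ac_real_comp (T L : R) (g : R -> 'rV[R]_n) (f : 'rV[R]_n -> R)
    (K : set 'rV[R]_n) : 0 <= L -> absolutely_continuous T g ->
  (forall t, 0 <= t <= T -> K (g t)) ->
  (forall x y, K x -> K y -> `|f y - f x| <= L * `|y - x|) ->
  ac_real T (f \o g).
Proof.
move=> L0 ac gK fL e e0.
have [|d d0 Hd] := ac (e / (L + 1)); first by rewrite divr_gt0// ltr_wpDl.
exists d => // m u v uv tr sd; have := Hd m u v uv tr sd.
rewrite ltr_pdivlMr ?ltr_wpDl//; apply: le_lt_trans.
rewrite mulr_suml; apply: ler_sum => j _; have [u0 uvj vT] := uv j.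
rewrite (le_trans (fL _ _ _ _))//.
- by apply: gK; rewrite u0 (le_trans uvj).
- by apply: gK; rewrite vT (le_trans u0).
by rewrite mulrC ler_wpM2l// lerDl.
Qed.

Lemma ac_modulus (T : R) (g : R -> 'rV[R]_n) (e : R) :
  absolutely_continuous T g -> 0 < e ->
  exists2 d : R, 0 < d & forall s t, 0 <= s <= T -> 0 <= t <= T ->
    `|t - s| < d -> `|g t - g s| < e.
Proof.
move=> ac e0; have [d d0 Hd] := ac e e0; exists d => // s t.
wlog st : s t / s <= t.
  move=> H sT tT; have [st|/ltW ts] := leP s t; first exact: H.
  by rewrite distrC [X in _ -> X < _]distrC; exact: H.
move=> /andP[s0 sT] /andP[t0 tT]; rewrite ger0_norm ?subr_ge0// => std.
have := Hd 1%N (fun=> s) (fun=> t); rewrite !big_ord1; apply => //.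
by apply/trivIsetP => i j _ _; rewrite (ord1 i) (ord1 j) eqxx.
Qed.

End absolutely_continuous_theory.

(** * Flows *)

Section flow_properties.
Context {R : realType} {n : nat}.
Notation mu := (@lebesgue_measure R).
Variables (S : set (LComega R n)) (x0 : 'rV[R]_n) (T rho C : R) (s : seq R).
Variables (X : R -> LComega R n) (g : R -> 'rV[R]_n).
Hypothesis regX : forall u, regular_times T s u ->
  S (X u) /\ \forall v \near u, X v =1 X u.
Hypothesis boundC : forall A i x, S A -> cball x0 rho x ->
  `|A (coordinate R i) x| <= C.
Hypotheses (C0 : 0 <= C) (rho0 : 0 < rho) (CT : C * T < rho).
Hypothesis flowg : is_flow T X x0 g.

Lemma flow_derive : {ae mu, forall t, 0 <= t <= T -> forall f : Comega R n,
  is_derive t 1 (f \o g : R -> R) (X t f (g t))}.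
Proof.
have aeF := ae_filter_ringOfSetsType mu.
have [_ _] := flowg; apply: filterS => t gt tT f.
have [V [_ VX dg]] := gt tT.
by rewrite VX; exact: is_derive_analytic_comp (Comega_analytic f) dg.
Qed.

(** At the infimum [c] of the exit times, the field along the curve has been bounded by [C] so far,
    so the distance to [x0] is at most [C * c < rho]. This strict inequality and continuity exclude
    an exit just after [c]. *)
Lemma flow_in_cball t : 0 <= t <= T -> cball x0 rho (g t).
Proof.
move=> tT; rewrite /cball/= leNgt; apply/negP => rt.
have aeF := ae_filter_ringOfSetsType mu.
have [acg g0 _] := flowg.
pose A := [set u | 0 <= u <= T /\ rho < `|g u - x0|].
have At : A t by [].
have A0 : has_inf A by split; [exists t|exists 0 => u [/andP[]]].
pose c := inf A.
have c0 : 0 <= c by apply: lb_le_inf; [exists t|move=> u [/andP[]]].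
have cT : c <= T.
  by have /andP[_] := tT; apply: le_trans; apply: ge_inf => //; case: A0.
have below u : 0 <= u < c -> cball x0 rho (g u).
  move=> /andP[u0 uc]; rewrite /cball/= leNgt; apply/negP => ru.
  suff : c <= u by rewrite leNgt uc.
  by apply: ge_inf; [case: A0|split => //; rewrite u0 ltW// (lt_le_trans uc)].
have gc : `|g c - x0| < rho.
  apply: ltr_row_norm => // i.
  rewrite (_ : (g c - x0) ord0 i = coordinate R i (g c) - coordinate R i (g 0));
    last first.
    by rewrite g0 /= !mxE.
  apply: le_lt_trans CT; apply: (@le_trans _ _ (C * c)); last by rewrite ler_wpM2l.
  apply: (@ac_derive_bound R c C (coordinate R i \o g)) => //; last by rewrite c0 lexx.
    apply: (ac_real_le cT); apply: (@ac_real_comp _ _ T 1 g _ setT) => // x y _ _.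
    by rewrite mul1r; have := ler_coord_norm (y - x) i; rewrite !mxE.
  (* [regular_times c [::]] discards the endpoint [u = c], since [below] covers only [u < c]. *)
  have := flow_derive; have := @ae_regular_times R T s;
    have := @ae_regular_times R c [::].
  apply: filterS3 => u uc uT du /andP[u0 ucc].
  have uT' : 0 <= u <= T by rewrite u0 (le_trans ucc).
  exists (X u (coordinate R i) (g u)); first exact: du.
  apply: boundC; first by have [] := regX (uT uT').
  by apply: below; rewrite u0; have [|/andP[]] := uc _; rewrite ?u0.
have [|d d0 Hd] := @ac_modulus _ _ T g (rho - `|g c - x0|) acg;
  first by rewrite subr_gt0.
have [u [/andP[u0 uT] ru]] := inf_adherent d0 A0; rewrite -/c => ucd.
have cu : c <= u by apply: ge_inf; [case: A0|split; rewrite ?u0].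
have := Hd c u; rewrite c0 cT u0 uT => /(_ isT isT).
rewrite ger0_norm ?subr_ge0// ltrBlDl => /(_ ucd) gu.
have := ler_normD (g u - g c) (g c - x0); rewrite addrA subrK.
by move: gu ru; lra.
Qed.

Lemma ac_flow_comp (f : Comega R n) : ac_real T (f \o g).
Proof.
have [L L0 fL] := lipschitz_on_cball f x0 rho.
have [acg _ _] := flowg.
exact: (@ac_real_comp _ _ T L g f (cball x0 rho) L0 acg flow_in_cball fL).
Qed.

Lemma flow_continuous u : 0 < u < T -> {for u, continuous g}.
Proof.
move=> /andP[u0 uT]; apply/cvgrPdist_lt => e e0.
have [acg _ _] := flowg; have [d d0 Hd] := ac_modulus acg e0.
have := near_in_itvoo (a := 0) (b := T) (x := u).
rewrite in_itv/= u0 uT => /(_ isT) uin; near=> v.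
have : v \in `]0, T[ by near: v.
rewrite in_itv/= => /andP[v0 vT]; rewrite distrC; apply: Hd; rewrite ?ltW// distrC.
Unshelve. all: by end_near. Qed.

Section along_flow.
Variables (f : Comega R n) (D : R).
Hypothesis D0 : 0 <= D.
Hypothesis boundD : forall A x, S A -> cball x0 rho x -> `|A f x| <= D.

Notation speed := (along_curve T s X g f).

Let speed_le := along_curve_le regX flow_in_cball D0 boundD.
Let speed_measurable := along_curve_measurable regX flow_continuous f.

(** [f \o g] minus the primitive of the speed is absolutely continuous with derivative 0 almost
    everywhere, so [ac_derive_bound] with [D = 0] makes it constant. *)
Lemma flow_integral t : 0 <= t <= T ->
  (f (g t) : R) = f x0 + primitive speed t.
Proof.
move=> tT; have [_ g0 _] := flowg.
have aeF := ae_filter_ringOfSetsType mu.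
have : `|((f \o g : R -> R) - primitive speed) t - ((f \o g : R -> R) - primitive
  speed) 0| <= 0 * t.
  apply: (@ac_derive_bound R T 0 _) => //.
    apply: ac_realB; first exact: ac_flow_comp.
    apply: (@ac_real_lipschitz _ _ D) => a b a0 ab bT.
    exact: (primitive_lipschitz speed_measurable speed_le).
  have := flow_derive; have := @ae_regular_times R T s.
  apply: filterS2 => u uG du uT; exists 0; last by rewrite normr0.
  have Gu := uG uT.
  have [/andP[u0 _] _] := Gu.
  have dp := is_derive_primitive speed_measurable speed_le u0 
    (along_curve_continuous regX flow_continuous Gu).
  rewrite -(subrr (X u f (g u) : R)).
  rewrite (along_curveE _ _ _ Gu) in dp; exact: is_deriveB (du uT f) dp.
rewrite mul0r normr_le0 subr_eq0 => /eqP; rewrite !fctE/= g0 primitive0 subr0 => <-.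
by rewrite subrK.
Qed.

Lemma flow_increment t : 0 <= t <= T -> `|f (g t) - f x0| <= D * t.
Proof.
move=> tT; rewrite (flow_integral tT) addrAC subrr add0r.
have /andP[t0 _] := tT.
have := primitive_lipschitz speed_measurable speed_le (lexx 0) t0.
by rewrite primitive0 !subr0.
Qed.

End along_flow.
End flow_properties.

(** * Error of the flow iterations *)

Section integrals.
Context {R : realType}.
Notation mu := (@lebesgue_measure R).

Lemma integral_monomial (D t : R) m : 0 <= t ->
  (\int[mu]_(u in `[0%R, t]) (D * u ^+ m / m`!%:R)%:E
   = (D * t ^+ m.+1 / m.+1`!%:R)%:E)%E.
Proof.
move=> t0; have m0 : m`!%:R != 0 :> R by rewrite pnatr_eq0 -lt0n fact_gt0.
have m10 : m.+1%:R != 0 :> R by rewrite pnatr_eq0.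
move: t0; rewrite le_eqVlt => /predU1P[<-|t0].
  by rewrite set_itv1 integral_set1 expr0n/= mulr0 mul0r.
pose F (u : R) : R := D / m.+1`!%:R * u ^+ m.+1.
have dF (u : R) : is_derive u 1 F (D * u ^+ m / m`!%:R).
  have := @is_deriveZ R R^o R^o _ (D / m.+1`!%:R) _ _ _ (@is_deriveX R R^o id m.+1
    u 1 1 (is_derive_id _ _)).
  move=> dZ; have -> : D * u ^+ m / m`!%:R
    = (D / m.+1`!%:R) *: ((m.+1%:R * id u ^+ m) *: (1 : R)).
    by rewrite factS natrM /GRing.scale/=; field; rewrite m0 nat1r m10.
  have FE : F = (D / m.+1`!%:R) *: ((id : R^o -> R) ^+ m.+1).
    by apply/funext => v; rewrite !fctE.
  by rewrite FE; exact: dZ.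
have cf : continuous (fun u : R => D * u ^+ m / m`!%:R).
  move=> u; apply: cvgMl; apply: cvgMr; exact: exprn_continuous.
rewrite (@continuous_FTC2 R _ F 0 t t0).
- by rewrite -EFinB /F expr0n/= mulr0 subr0 mulrAC.
- exact: continuous_subspaceT.
- have cF : continuous F by move=> u; apply: cvgMr; exact: exprn_continuous.
  split.
  + by move=> u _; case: (dF u).
  + exact/cvg_at_right_filter/cF.
  + exact/cvg_at_left_filter/cF.
- by move=> u _; rewrite derive1E; case: (dF u).
Qed.

Lemma Rintegral_simple (J : set R) (m : nat) (A : 'I_m -> set R) (c : 'I_m -> R) :
  measurable J -> (mu J < +oo)%E -> (forall j, measurable (A j)) ->
  \int[mu]_(u in J) (\sum_j \1_(A j) u * c j)
    = \sum_j fine (mu (A j `&` J)) * c j.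
Proof.
move=> mJ Joo mA.
have bd j (u : R) : `|\1_(A j) u * c j| <= `|c j|.
  by rewrite normrM ler_piMl// ger0_norm// indicE; case: (_ \in _).
have ms j : measurable_fun setT (fun u : R => \1_(A j) u * c j).
  by apply: measurable_funM => //; exact: measurable_indic.
elim: (index_enum 'I_m) => [|j r IH].
  under eq_Rintegral do rewrite big_nil.
  by rewrite Rintegral_cst// mul0r big_nil.
under eq_Rintegral do rewrite big_cons.
rewrite big_cons RintegralD//.
- rewrite IH RintegralZr//.
    by rewrite /Rintegral integral_indic; [|exact: mJ|exact: mA].
  apply: (bounded_integrable (C := 1) mJ Joo).
    by apply: measurable_indic; exact: mA.
  by move=> u; rewrite ger0_norm// indicE; case: (_ \in _).
- exact: (bounded_integrable (C := `|c j|) mJ Joo).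
- apply: (bounded_integrable (C := \sum_(i <- r) `|c i|) mJ Joo).
    exact: measurable_sum.
  by move=> u; rewrite (le_trans (ler_norm_sum _ _ _))// ler_sum.
Qed.

End integrals.

Section evaluation.
Context {R : realType} {n : nat}.

Lemma Comega_sumE m (F : 'I_m -> Comega R n) (a : 'I_m -> R)
    (x : 'rV[R]_n) :
  (\sum_j a j *: F j : Comega R n) x = \sum_j a j * F j x :> R.
Proof. by rewrite (big_morph (fun F : Comega R n => F x : R) (id1 := 0) (op1 :=
  +%R)). Qed.

End evaluation.

Section iteration_error.
Context {R : realType} {n : nat}.
Notation mu := (@lebesgue_measure R).
Variables (S : set (LComega R n)) (x0 : 'rV[R]_n) (T r C : R) (s : seq R).
Variables (X : R -> LComega R n) (g : R -> 'rV[R]_n).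
Hypothesis boundedS : omega_bounded S.
Hypothesis regX : forall u, regular_times T s u ->
  S (X u) /\ \forall v \near u, X v =1 X u.
Hypothesis boundC : forall A i x, S A -> cball x0 r x ->
  `|A (coordinate R i) x| <= C.
Hypotheses (C0 : 0 <= C) (r0 : 0 < r) (CT : C * T < r).
Hypothesis flowg : is_flow T X x0 g.

(** Induction on [k] with [f] free: the integrand replaces [f] by [X u f], which varies with [u] but
    keeps the same [D]. Only the errors [err d] are assumed measurable, not [E' u (X u f) x0], so
    the speed is compared with evaluated simple curves and the limit along the net is taken last. *)
Lemma iteration_error k (f : Comega R n) (D : R) E (t : R) : 0 <= D ->
  iterated_bound S (cball x0 r) k.+1 f D ->
  is_flow_iteration T X k E -> 0 <= t <= T ->
  `|f (g t) - E t f x0| <= D * t ^+ k.+1 / k.+1`!%:R.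
Proof.
elim: k f E t => [|k IH] f E t D0 bD /=.
  move=> Ef tT; rewrite Ef// expr1 factS fact0 muln1 divr1.
  exact: (@flow_increment R n S x0 T r C s X g regX boundC C0 r0 CT flowg f D D0
    (fun A x SA Kx => bD A SA x Kx) t tT).
move=> [E' itE' Eint] tT; have /andP[t0 tT'] := tT.
have [I [Dt [F [sc [PF intI]]]] EI] := Eint t tT.
have [D' D'0 bD'] := omega_bounded_cball f x0 r boundedS.
set h := along_curve T s X g f.
have gK := flow_in_cball regX boundC C0 r0 CT flowg.
have mh := along_curve_measurable regX (flow_continuous flowg) f.
have hD' := along_curve_le regX gK D'0 bD'.
rewrite (flow_integral regX boundC C0 r0 CT flowg D'0 bD' tT) EI.
have -> : f x0 + primitive h t - (f + I f) x0 = primitive h t - I f x0 :> R.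
  by rewrite [(f + I f) x0](_ : _ = f x0 + I f x0)//; ring.
(* Evaluation at [x0] is dominated by this seminorm, by [rho_ge]. *)
have [merr interr rhoerr] := intI [set x0] harmonic f (@compact_set1 _ _)
  c0_decreasing_harmonic.
pose sg d u : R := \sum_j \1_(sc_set (s := sc d) j) u * sc_val j f x0.
pose J : set R := `[0, t]%classic.
have mJ : measurable J by exact: measurable_itv.
have Joo : (mu J < +oo)%E.
  rewrite lebesgue_measure_itv/=; case: ifPn => _; last by rewrite ltry.
  by rewrite -EFinB ltry.
have sgE d u : simple_eval (sc d) u f x0 = sg d u :> R by exact: Comega_sumE.
have msg d : measurable_fun setT (sg d).
  apply: measurable_sum => j; apply: measurable_funM => //.
  by apply: measurable_indic; exact: sc_measurable.
have bsg d u : `|sg d u| <= \sum_j `|sc_val (s := sc d) j f x0|.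
  rewrite (le_trans (ler_norm_sum _ _ _))// ler_sum// => j _.
  by rewrite normrM ler_piMl// ger0_norm// indicE; case: (_ \in _).
have isg d : \int[mu]_(u in J) sg d u = simple_integral (sc d) J f x0.
  by rewrite Rintegral_simple ?Comega_sumE// => j; exact: sc_measurable.
set P := D * t ^+ k.+2 / k.+2`!%:R.
pose err d u := rho [set x0] harmonic f
    (fun f' : Comega R n => E' u (X u f') - simple_eval (sc d) u f').
have err0 d u : (0 <= err d u)%E by rewrite /err /rho le_max lexx.
pose b (u : R) : R := D * u ^+ k.+1 / k.+1`!%:R.
have b0 u : J u -> (0 <= (b u)%:E)%E.
  rewrite /J/= in_itv/= => /andP[u0 _].
  by rewrite lee_fin divr_ge0// mulr_ge0// exprn_ge0.
have mb : measurable_fun J (fun u => (b u)%:E).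
  apply/measurable_EFinP; apply: measurable_funTS; apply: continuous_measurable_fun.
  by move=> u; apply: cvgMl; apply: cvgMr; exact: exprn_continuous.
have ih := itv_integrable 0 t true false mh hD'.
have isgJ d := itv_integrable 0 t true false (msg d) (bsg d).
have ihs d : mu.-integrable J (EFin \o (fun u => h u - sg d u)).
  apply: (itv_integrable (C := D' + \sum_j `|sc_val (s := sc d) j f x0|)).
    exact: measurable_funB.
  by move=> u; rewrite (le_trans (ler_normB _ _))// lerD.
(* At almost every [u] the integrand splits at [E' u (X u f) x0]: the induction hypothesis for
   [X u f] bounds one part by [b u], the seminorm bounds the other by [err d u]. The integral of [b]
   is [P]. *)
have main d : (`|primitive h t - \int[mu]_(u in J) sg d u|%:E
    <= P%:E + \int[mu]_(u in J) err d u)%E.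
  rewrite /primitive -RintegralB; [|exact: mJ|exact: ih|exact: isgJ].
  rewrite EFin_normr_Rintegral; [|exact: mJ|exact: ihs].
  apply: le_trans; first (apply: le_abse_integral; first exact: mJ).
    by have /integrableP[] := ihs d.
  rewrite -(integral_monomial D k.+1 t0) -ge0_integralD;
    [|exact: mJ|exact: b0|exact: mb|by []|exact: merr].
  apply: ae_ge0_le_integral; first exact: mJ.
  - by [].
  - by apply: measurableT_comp => //; have /integrableP[] := ihs d.
  - by move=> u Ju; rewrite adde_ge0// b0.
  - by apply: emeasurable_funD => //; exact: merr.
  have aeF := ae_filter_ringOfSetsType mu.
  have := @ae_regular_times R T s; apply: filterS => u uG; rewrite /J/= in_itv/=.
  move=> /andP[u0 ut]; have uT : 0 <= u <= T by rewrite u0 (le_trans ut).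
  have [SXu _] := regX (uG uT).
  have hu : h u = X u f (g u) by apply: along_curveE; exact: uG.
  have e1 := IH (X u f) E' u D0 (bD _ SXu) itE' uT.
  have e2 := @rho_ge R n [set x0] f
    (fun f' : Comega R n => E' u (X u f') - simple_eval (sc d) u f') x0 erefl.
  apply: (@le_trans _ _ (b u + `|E' u (X u f) x0 - sg d u|)%:E).
    rewrite lee_fin hu (_ : _ - sg d u =
      (X u f (g u) - E' u (X u f) x0) + (E' u (X u f) x0 - sg d u)); last by ring.
    by rewrite (le_trans (ler_normD _ _))// lerD.
  by rewrite EFinD leeD2l// -sgE.
have fin d : (`|primitive h t - I f x0|%:E <= P%:E +
    \int[mu]_(u in J) err d u +
    rho [set x0] harmonic f (fun f' => (I f' - simple_integral (sc d) J f')%R))%E.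
  apply: (@le_trans _ _ (`|primitive h t - \int[mu]_(u in J) sg d u|%:E +
      `|I f x0 - simple_integral (sc d) J f x0|%:E)%E).
    rewrite -EFinD lee_fin isg [X in _ <= _ + X]distrC.
    set a : R := simple_integral (sc d) J f x0.
    rewrite (_ : _ - I f x0 = (primitive h t - a) + (a - I f x0)); last by ring.
    by rewrite ler_normD.
  apply: leeD => //.
  exact: (@rho_ge R n [set x0] f (fun f' => I f' - simple_integral (sc d) J f') x0
    erefl).
apply/ler_addgt0Pr => e e0; have e20 : 0 < e / 2 by rewrite divr_gt0.
have N1 : F [set d | (\int[mu]_(u in J) err d u < (e / 2)%:E)%E].
  exact: interr _ (@nbhs_open_ereal_lt _ 0 (fun=> e / 2) e20).
have N2 : F [set d | (rho [set x0] harmonic f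
    (fun f' => (I f' - simple_integral (sc d) J f')%R) < (e / 2)%:E)%E].
  exact: rhoerr _ (@nbhs_open_ereal_lt _ 0 (fun=> e / 2) e20).
have [d [/= d1 d2]] := filter_ex (filterI N1 N2).
rewrite -lee_fin; apply: le_trans (fin d) _.
have -> : ((P + e)%:E = P%:E + (e / 2)%:E + (e / 2)%:E)%E.
  by rewrite -!EFinD -addrA -splitr.
by apply: leeD; [apply: leeD => //|]; exact: ltW.
Qed.

End iteration_error.

(** * Existence of the flow *)

Section geometric.
Context {R : realType}.

Lemma le0_of_geometric (a b : R) : (forall m, a <= b * 2^-1 ^+ m) -> a <= 0.
Proof.
move=> ab; have c0 : b * 2^-1 ^+ m @[m --> \oo] --> (0 : R).
  rewrite -[X in _ --> X](mulr0 b); apply: cvgMr; apply: cvg_expr.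
  by rewrite ger0_norm ?invr_ge0// invf_lt1// ltr1n.
have cl : closed [set z : R | a <= z] by exact: closed_ge.
by apply: (closed_cvg _ cl _ _ c0); apply: nearW => m; exact: ab.
Qed.

Lemma cvg_of_geometric (u : nat -> R) (r : R) :
  (forall m, `|u m.+1 - u m| <= r * 2^-1 ^+ m) ->
  exists2 l, u @ \oo --> l & forall m, `|l - u m| <= 2 * r * 2^-1 ^+ m.
Proof.
move=> ur.
have r0 : 0 <= r by have := ur 0%N; rewrite expr0 mulr1; exact: le_trans.
(* The factor [1 - 2^-1 ^+ j] is the exact partial geometric sum and lets the induction close. *)
have far m j : `|u (m + j)%N - u m| <= 2 * r * 2^-1 ^+ m * (1 - 2^-1 ^+ j).
  elim: j => [|j IH]; first by rewrite addn0 subrr normr0 expr0 subrr mulr0.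
  rewrite addnS -[u (m + j).+1](subrK (u (m + j)%N)) -addrA.
  rewrite (le_trans (ler_normD _ _))// (le_trans (lerD (ur _) IH))//.
  rewrite exprD exprS le_eqVlt; apply/orP; left; apply/eqP.
  have -> : (2^-1 : R) = 1 / 2 by rewrite mul1r.
  by field.
have far' m k : (m <= k)%N -> `|u k - u m| <= 2 * r * 2^-1 ^+ m.
  move=> mk; rewrite -(subnKC mk) (le_trans (far _ _))//; apply: ler_piMr.
    by rewrite mulr_ge0 ?mulr_ge0// exprn_ge0// invr_ge0.
  by rewrite gerBl exprn_ge0// invr_ge0.
have cu : cvgn u.
  apply/cauchy_cvgP; apply: cauchy_exP => e e0.
  have [m me] : exists m, 2 * r * 2^-1 ^+ m < e.
    apply: contrapT => /forallNP H; suff : e <= 0 by rewrite leNgt e0.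
    by apply: (@le0_of_geometric _ (2 * r)) => m; rewrite leNgt; apply/negP/H.
  exists (u m); apply: filterS (nbhs_infty_ge m) => k mk.
  by rewrite /ball/= distrC (le_lt_trans (far' m k mk)).
exists (limn u) => // m.
apply: (@limr_norm_le _ (fun k => u k - u m)).
  by apply: cvgB => //; exact: cvg_cst.
by apply: filterS (nbhs_infty_ge m) => k; exact: far'.
Qed.

End geometric.

Section picard.
Context {R : realType} {n : nat}.
Notation mu := (@lebesgue_measure R).
Variables (S : set (LComega R n)) (x0 : 'rV[R]_n) (T r C Lam : R) (s : seq R).
Variables (X : R -> LComega R n).
Hypothesis regX : forall u, regular_times T s u ->
  S (X u) /\ \forall v \near u, X v =1 X u.
Hypothesis boundC : forall A i x, S A -> cball x0 r x ->
  `|A (coordinate R i) x| <= C.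
Hypothesis lipS : forall A i x y, S A -> cball x0 r x -> cball x0 r y ->
  `|A (coordinate R i) y - A (coordinate R i) x| <= Lam * `|y - x|.
Hypotheses (C0 : 0 <= C) (r0 : 0 < r) (CT : C * T < r).
Hypotheses (Lam0 : 0 <= Lam) (LamT : Lam * T <= 2^-1).

(** Both conditions survive pointwise limits, so the limit of the Picard iterates is admissible. The
    Lipschitz condition supplies the continuity behind the measurability of the velocity. *)
Definition admissible (g : R -> 'rV[R]_n) : Prop :=
  (forall t, 0 <= t <= T -> cball x0 r (g t)) /\
  (forall a b, 0 <= a -> a <= b -> b <= T -> `|g b - g a| <= C * (b - a)).

Notation velocity g i := (along_curve T s X g (coordinate R i)).

Definition picard g t : 'rV[R]_n := x0 + \row_i primitive (velocity g i) t.

Lemma admissible_continuous g u : admissible g -> 0 < u < T ->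
  {for u, continuous g}.
Proof.
move=> [_ lip] /andP[u0 uT]; apply/cvgrPdist_lt => e e0.
have := near_in_itvoo (a := 0) (b := T) (x := u).
rewrite in_itv/= u0 uT => /(_ isT) uin.
have d0 : 0 < e / (C + 1) by rewrite divr_gt0// ltr_wpDl.
near=> v; have : v \in `]0, T[ by near: v.
rewrite in_itv/= => /andP[v0 vT].
have uv : `|u - v| < e / (C + 1) by near: v; exact: (nbhsx_ballx u _ d0).
rewrite ltr_pdivlMr ?ltr_wpDl// in uv; apply: le_lt_trans uv.
apply: (@le_trans _ _ (C * `|u - v|)); last by rewrite mulrC ler_wpM2l// lerDl.
have [vu|/ltW uv] := leP v u.
  by rewrite (@ger0_norm _ (u - v)) ?subr_ge0// lip// ltW.
by rewrite distrC (distrC u) (@ger0_norm _ (v - u)) ?subr_ge0// lip// ltW.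
Unshelve. all: by end_near. Qed.

Lemma velocity_le g i : admissible g -> forall u, `|velocity g i u| <= C.
Proof.
move=> ag; apply: (along_curve_le regX ag.1 C0) => A x; exact: boundC.
Qed.

Lemma velocity_measurable g i : admissible g -> measurable_fun setT (velocity g i).
Proof.
by move=> ag; apply: (along_curve_measurable regX) => u; exact: admissible_continuous.
Qed.

Lemma picard0 g : picard g 0 = x0.
Proof. by apply/rowP => i; rewrite !mxE primitive0 addr0. Qed.

Lemma admissible_picard g : admissible g -> admissible (picard g).
Proof.
move=> ag.
have lip a b : 0 <= a -> a <= b -> b <= T -> `|picard g b - picard g a| <= C * (b - a).
  move=> a0 ab bT; apply: ler_row_norm; first by rewrite mulr_ge0// subr_ge0.
  move=> i; rewrite !mxE opprD addrACA subrr add0r.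
  exact: (primitive_lipschitz (velocity_measurable i ag) (velocity_le i ag)).
split => // t /andP[t0 tT]; rewrite /cball/= -(picard0 g).
apply: (@le_trans _ _ (C * (t - 0))); first exact: lip.
by rewrite subr0 (le_trans _ (ltW CT))// ler_wpM2l.
Qed.

Lemma picard_contraction g g' E : admissible g -> admissible g' -> 0 <= E ->
  (forall t, 0 <= t <= T -> `|g t - g' t| <= E) ->
  forall t, 0 <= t <= T -> `|picard g t - picard g' t| <= E * 2^-1.
Proof.
move=> ag ag' E0 gE t /andP[t0 tT].
apply: ler_row_norm; first by rewrite mulr_ge0// invr_ge0.
move=> i; rewrite !mxE opprD addrACA subrr add0r.
apply: (@le_trans _ _ (Lam * E * t)); last first.
  rewrite mulrAC mulrC ler_wpM2l// (le_trans _ LamT)// ler_wpM2l//.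
apply: (primitive_diff (velocity_measurable i ag) (velocity_measurable i ag')
  (velocity_le i ag) (velocity_le i ag')) => // u.
rewrite /along_curve !patchE; case: ifPn => [/set_mem Gu|_]; last first.
  by rewrite subrr normr0 mulr_ge0.
have uT : 0 <= u <= T by case: Gu => /andP[? ?] _; rewrite !ltW.
apply: (@le_trans _ _ (Lam * `|g u - g' u|)); last by rewrite ler_wpM2l// gE.
apply: lipS; first by have [] := regX Gu.
  by have [+ _] := ag'; exact.
by have [+ _] := ag; exact.
Qed.

Lemma picard_fixpoint : exists2 g, admissible g &
  forall t, 0 <= t <= T -> picard g t = g t.
Proof.
pose gm m := iter m picard (fun=> x0).
have agm m : admissible (gm m).
  elim: m => [|m IH]; last exact: admissible_picard.
  split=> [t _|a b a0 ab bT]; first by rewrite /cball/= subrr normr0 ltW.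
  by rewrite subrr normr0 mulr_ge0// subr_ge0.
(* The first step is at most [r] because the iteration starts at the centre of the ball; each
   further one halves the distance. *)
have step m t : 0 <= t <= T -> `|gm m.+1 t - gm m t| <= r * 2^-1 ^+ m.
  elim: m t => [|m IH] t tT.
    by rewrite expr0 mulr1; have [+ _] := agm 1%N; exact.
  have E0 : 0 <= r * 2^-1 ^+ m by rewrite mulr_ge0 ?exprn_ge0 ?invr_ge0// ltW.
  by rewrite exprSr mulrA; exact: (picard_contraction (agm m.+1) (agm m) E0 IH).
have lim_gm (ti : R * 'I_n) : exists l, 0 <= ti.1 <= T ->
    gm m ti.1 ord0 ti.2 @[m --> \oo] --> l /\
    forall m, `|l - gm m ti.1 ord0 ti.2| <= 2 * r * 2^-1 ^+ m.
  case: ti => t i /=; have [tT|tT] := boolP (0 <= t <= T); last by exists 0.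
  have [|l cl Hl] := @cvg_of_geometric R (fun m => gm m t ord0 i) r; last by exists l.
  move=> m; apply: le_trans (step m t tT).
  by have := ler_coord_norm (gm m.+1 t - gm m t) i; rewrite !mxE.
have [l Hl] := choice lim_gm.
pose g t : 'rV[R]_n := \row_i l (t, i).
have ag : admissible g.
  split=> [t tT|a b a0 ab bT].
    apply: ler_row_norm; first exact: ltW.
    move=> i; have [/= cl _] := Hl (t, i) tT.
    apply: (@limr_norm_le _ (fun m => gm m t ord0 i - x0 ord0 i)).
      by rewrite !mxE; apply: cvgB => //; exact: cvg_cst.
    apply: nearW => m; have [+ _] := agm m => /(_ t tT); apply: le_trans.
    by have := ler_coord_norm (gm m t - x0) i; rewrite !mxE.
  apply: ler_row_norm; first by rewrite mulr_ge0// subr_ge0.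
  move=> i; have [|/= cla _] := Hl (a, i); first by rewrite a0 (le_trans ab).
  have [|/= clb _] := Hl (b, i); first by rewrite bT (le_trans a0).
  apply: (@limr_norm_le _ (fun m => gm m b ord0 i - gm m a ord0 i)).
    by rewrite !mxE; exact: cvgB.
  apply: nearW => m; have [_ +] := agm m => /(_ a b a0 ab bT); apply: le_trans.
  by have := ler_coord_norm (gm m b - gm m a) i; rewrite !mxE.
have gE m t : 0 <= t <= T -> `|gm m t - g t| <= 2 * r * 2^-1 ^+ m.
  move=> tT; have E0 : 0 <= 2 * r * 2^-1 ^+ m.
    by rewrite mulr_ge0 ?exprn_ge0 ?invr_ge0// mulr_ge0// ltW.
  apply: ler_row_norm => // i; have [_ /(_ m)] := Hl (t, i) tT.
  by rewrite !mxE distrC.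
exists g => // t tT; apply/eqP; rewrite -subr_eq0 -normr_le0.
apply: (@le0_of_geometric _ _ (2 * r)) => m.
have E0 : 0 <= 2 * r * 2^-1 ^+ m.
  by rewrite mulr_ge0 ?exprn_ge0 ?invr_ge0// mulr_ge0// ltW.
have h1 := gE m.+1 t tT.
have h2 := picard_contraction (agm m) ag E0 (gE m) tT.
rewrite -[picard g t](subrK (gm m.+1 t)) -addrA (le_trans (ler_normD _ _))//.
rewrite distrC (le_trans (lerD h2 h1))// exprS le_eqVlt; apply/orP; left; apply/eqP.
have -> : (2^-1 : R) = 1 / 2 by rewrite mul1r.
by field.
Qed.

Lemma exists_flow : (forall A, S A -> exists2 V, Gamma_omega V & is_derivation_of V
  A) ->
  exists g, is_flow T X x0 g.
Proof.
move=> SV; have [g ag fg] := picard_fixpoint.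
(* [picard g] is built from primitives and can be differentiated directly; it agrees with [g] on
   [[0, T]], which identifies its velocity. *)
exists (picard g); have [_ lip] := admissible_picard ag.
split; [|exact: picard0|].
- move=> e e0; exists (e / (C + 1)); first by rewrite divr_gt0// ltr_wpDl.
  move=> m u v uv _; rewrite ltr_pdivlMr ?ltr_wpDl//; apply: le_lt_trans.
  rewrite mulr_suml; apply: ler_sum => j _; have [u0 uvj vT] := uv j.
  by rewrite (le_trans (lip _ _ u0 uvj vT))// mulrC ler_wpM2l ?subr_ge0// lerDl.
have aeF := ae_filter_ringOfSetsType mu.
have := @ae_regular_times R T s; apply: filterS => u uG uT.
have Gu := uG uT; have [SXu _] := regX Gu; have [/andP[u0 _] _] := Gu.
have [V GV VX] := SV _ SXu; exists V; split => //.
have dcoord i : is_derive u 1 (fun t => picard g t ord0 i : R) (V (picard g u) ord0 i).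
  have := is_derive_primitive (velocity_measurable i ag) (velocity_le i ag) u0
    (along_curve_continuous regX (fun v => admissible_continuous ag) Gu).
  rewrite [velocity g i u](_ : _ = V (picard g u) ord0 i); last first.
    by rewrite along_curveE// (derivation_coordinate _ _ VX) fg.
  rewrite (_ : (fun t => picard g t ord0 i : R) = cst (x0 ord0 i) + primitive
    (velocity g i)).
    move=> dp; rewrite -[X in is_derive _ _ _ X]add0r; apply: is_deriveD.
  by apply/funext => t; rewrite !mxE.
have dp : derivable (picard g) u 1.
  by apply/derivable_mxP => j i; rewrite (ord1 j); case: (dcoord i).
apply: DeriveDef => //; rewrite derive_mx//; apply/rowP => i; rewrite mxE.
by case: (dcoord i).
Qed.

End picard.

(** * Restriction and extension in time *)

Section restriction.
Context {R : realType} {n : nat}.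
Notation mu := (@lebesgue_measure R).

Lemma flow_iteration_restrict (T T' : R) (X X' : R -> LComega R n) k E :
  T <= T' -> (forall u, u <= T -> X' u = X u) ->
  is_flow_iteration T' X' k E -> is_flow_iteration T X k E.
Proof.
move=> TT' XX'; elim: k E => [|k IH] E /=.
  by move=> Ef t /andP[t0 tT] f; apply: Ef; rewrite t0 (le_trans tT).
move=> [E' /IH itE' Eint]; exists E' => // t /andP[t0 tT].
have [|I [D [F [sc [PF intI]]]] EI] := Eint t; first by rewrite t0 (le_trans tT).
exists I; last exact: EI.
exists D, F, sc; split; first exact: PF.
move=> K a f cK ca.
have [m1 m2 m3] := intI K a f cK ca.
have errE d (u : R) : u \in (`[0, t]%classic : set R) ->
    rho K a f (fun g => (E' u \o X' u) g - simple_eval (sc d) u g)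
    = rho K a f (fun g => (E' u \o X u) g - simple_eval (sc d) u g).
  by rewrite inE/= in_itv/= => /andP[_ ut]; rewrite XX'// (le_trans ut).
split; last exact: m3.
- by move=> d; apply: eq_measurable_fun (m1 d) => u /errE ->.
- move: m2; apply: cvg_trans; apply: near_eq_cvg; apply: nearW => d.
  by apply: eq_integral => u /errE ->.
Qed.

(** Iterations are granted for curves on the long interval only. A curve on the short one is
    therefore continued by a constant in [S], with [T] as a new break point, and the iteration is
    restricted back. *)
Lemma PC_extend (T T' : R) (S : set (LComega R n)) X A : S A -> PC T S X ->
  PC T' S (fun u => if u <= T then X u else A).
Proof.
move=> SA [[s Xs] aeS]; split.
  exists (T :: s) => u v u0 uv vT' sw.
  have [vT|Tv] := leP v T.
    rewrite (le_trans uv vT); apply: Xs => // w ws.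
    by apply: sw; rewrite inE ws orbT.
  have [uT|//] := leP u T.
  by have := sw T (mem_head _ _); rewrite uT (ltW Tv).
have aeF := ae_filter_ringOfSetsType mu.
apply: filterS aeS => u Su /andP[u0 uT'].
by case: ifPn => // uT; apply: Su; rewrite u0.
Qed.

Lemma PC_nonempty (T : R) (S : set (LComega R n)) X : 0 < T -> PC T S X ->
  exists A, S A.
Proof.
move=> T0 [_ aeS]; have T20 : 0 < T / 2 by rewrite divr_gt0.
have [v vT Sv] := ae_in_ball (T / 2) T20 aeS.
by exists (X v); apply: Sv; move: vT; rewrite ltr_norml => /andP[? ?]; apply/andP;
  split; lra.
Qed.

End restriction.

(** * Choice of the constants and conclusion *)

Theorem theorem3p7 (R : realType) (n : nat)
    (B : set ('rV[R]_n -> 'rV[R]_n)) (x0 : 'rV[R]_n) (TB : R) :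
  B `<=` @Gamma_omega R n ->
  omega_bounded (derivations B) ->
  0 < TB ->
  (forall X, PC TB (derivations B) X -> forall k, (0 < k)%N ->
     exists E, is_flow_iteration TB X k E) ->
  exists M L T : R,
    [/\ 0 < M, 0 < L, 0 < T, T <= TB & M * T < 1] /\
    forall X, PC T (derivations B) X ->
      (exists g, is_flow T X x0 g) /\
      forall k, (0 < k)%N ->
        (exists E, is_flow_iteration T X k E) /\
        forall g E, is_flow T X x0 g -> is_flow_iteration T X k E ->
          forall (i : 'I_n) (t : R), 0 <= t <= T ->
            `|coordinate R i (g t) - E t (coordinate R i) x0|
              <= (M * t) ^+ k.+1 / (1 - M * t) * L.
Proof.
move=> BG bB TB0 itB.
have [M M0 HM] := derivations_jet_bound bB (@compact_cball R n x0 1).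
(* The empty word of the jet bound gives the speed limit, one-letter words the Lipschitz
   constant. *)
have boundC A i x : derivations B A -> cball x0 1 x -> `|A (coordinate R i) x| <= M.
  by move=> BA Kx; have := HM A i x BA Kx [::];
    rewrite /= expr0 add0n fact0 divff ?mulr1.
have lipS A i x y : derivations B A -> cball x0 1 x -> cball x0 1 y ->
    `|A (coordinate R i) y - A (coordinate R i) x| <= n%:R * M ^+ 2 * `|y - x|.
  move=> BA Kx Ky; apply: (@real_analytic_lipschitz _ _ _ (cball x0 1)) => //.
  - exact: Comega_analytic.
  - by move=> *; exact: cball_convex.
  - move=> j z Kz; have := HM A i z BA Kz [:: j].
    by rewrite /= expr1 add0n factS fact0 muln1 divff ?mulr1 -?expr2.
pose Lam := n%:R * M ^+ 2; have Lam0 : 0 <= Lam by rewrite mulr_ge0// sqr_ge0.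
pose Q := 2 * n%:R * M ^+ 2; have QE : Q = 2 * Lam by rewrite /Q /Lam mulrA.
(* [Q] covers the iterated bound and, being [2 * Lam], the contraction; [M] keeps the flow in the
   unit ball; the 1 gives [M' ^+ k <= M' ^+ k.+1]. *)
pose M' := Q + M + 1.
have M'1 : 1 <= M' by rewrite /M'; nra.
have M'0 : 0 < M' by rewrite (lt_le_trans _ M'1).
(* This gives [M' * t <= 1 / 2], hence a positive denominator and a Picard contraction by one
   half. *)
pose T := Num.min TB (2 * M')^-1.
have T0 : 0 < T by rewrite lt_min TB0 invr_gt0 mulr_gt0.
have TTB : T <= TB by rewrite ge_min lexx.
have MT : M' * T <= 2^-1.
  apply: (@le_trans _ _ (M' * (2 * M')^-1)).
    by rewrite ler_pM2l// ge_min lexx orbT.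
  by rewrite invfM mulrCA divff ?mulr1// gt_eqF.
have CT : M * T < 1.
  apply: (@le_lt_trans _ _ (M' * T));
    last by rewrite (le_lt_trans MT)// invf_lt1// ltr1n.
  by rewrite ler_pM2r// /M'; nra.
have LamT : Lam * T <= 2^-1.
  by rewrite (le_trans _ MT)// ler_pM2r// /M' QE; nra.
exists M', M, T; split.
  by split => //; rewrite (le_lt_trans MT)// invf_lt1// ltr1n.
move=> X PCX.
have [s regX] := PC_regular (@eq_closed_derivations R n B) PCX.
have [A0 SA0] := PC_nonempty T0 PCX.
split.
  apply: (exists_flow regX boundC lipS (ltW M0) ltr01 CT Lam0 LamT).
  by move=> A [V BV VA]; exists V => //; exact: BG.
move=> k k0; split.
  have [E itE] := itB _ (PC_extend TB SA0 PCX) k k0.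
  exists E; apply: (flow_iteration_restrict TTB _ itE).
  by move=> u uT; rewrite uT.
move=> g E flowg itE i t tT; have /andP[t0 tT'] := tT.
have bD := iterated_boundP (ltW M0) HM k i.
have D0 : 0 <= M * Q ^+ k * k`!%:R.
  by rewrite !mulr_ge0 ?exprn_ge0 ?mulr_ge0 ?sqr_ge0 ?(ltW M0).
have := iteration_error bB regX boundC (ltW M0) ltr01 CT flowg D0 bD itE tT.
move=> /le_trans; apply.
have Mt : M' * t <= 2^-1 by rewrite (le_trans _ MT)// ler_pM2l.
have Mt0 : 0 <= M' * t by rewrite mulr_ge0// ltW.
(* The denominator [1 - M' * t] lies in []0, 1]], so the estimate without it is stronger. *)
apply: (@le_trans _ _ (M * (M' * t) ^+ k.+1)); last first.
  rewrite mulrC ler_wpM2r ?(ltW M0)// ler_pdivlMr; last by lra.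
  by rewrite ler_piMr ?exprn_ge0// gerBl.
have k0' : k`!%:R != 0 :> R by rewrite pnatr_eq0 -lt0n fact_gt0.
have k1 : k.+1%:R != 0 :> R by rewrite pnatr_eq0.
have -> : M * Q ^+ k * k`!%:R * t ^+ k.+1 / k.+1`!%:R
    = M * (Q ^+ k * k.+1%:R^-1 * t ^+ k.+1).
  by rewrite factS natrM; field; rewrite k0' nat1r k1.
rewrite [(M' * t) ^+ _]exprMn ler_pM2l//.
rewrite ler_wpM2r ?exprn_ge0//; apply: (@le_trans _ _ (Q ^+ k)).
  apply: ler_piMr; first by rewrite exprn_ge0// QE mulr_ge0.
  by rewrite invf_le1// ler1n.
apply: (@le_trans _ _ (M' ^+ k)); last by rewrite ler_weXn2l.
apply: lerXn2r; rewrite ?nnegrE ?(ltW M'0)//; first by rewrite QE mulr_ge0.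
by rewrite /M' -addrA lerDl addr_ge0// ltW.
Qed.
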